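(* For a finite group $G$ and a divisor $d$ of $|G|$, let $\nu(d)$ be the number of elements of order $d$ in $G$, let $r_0(d)$ be the number of conjugacy classes of elements of order $d$ in $G$, let $r_1(d)$ be the number of conjugacy classes of unordered pairs $\{g,g^{-1}\}$ of elements of order $d$ in $G$, and let $r_2(d)$ be the number of conjugacy classes of cyclic subgroups of $G$ of order $d$. (a) If $G=T^{*}$, these numbers are given by: $$\begin{array}{c|ccccc} d & 1&2&3&4&6\\ \hline \nu(d)&1&1&8&6&8\\ r_0(d)&1&1&2&1&2\\ r_1(d)&1&1&1&1&1\\ r_2(d)&1&1&1&1&1\end{array}$$ If $d\in\{3,6\}$ and $g\in T^{*}$ is of order $d$, then $g$ and $g^{-1}$ are representatives of the two conjugacy classes of elements of order $d$. (b) If $G=O^{*}$, these numbers are given by: $$\begin{array}{c|cccccc} d & 1&2&3&4&6&8\\ \hline \nu(d)&1&1&8&18&8&12\\ r_0(d)&1&1&1&2&1&2\\ r_1(d)&1&1&1&2&1&2\\ r_2(d)&1&1&1&2&1&1\end{array}$$ If $d=4$, and $g_1$ and $g_2$ are elements of $O^{*}$ of order $4$ such that $g_1\in T^{*}$ and $g_2\notin T^{*}$, then $g_1$ and $g_2$ are representatives of the two conjugacy classes of elements of order $4$. If $d=8$ and $g\in O^{*}$ is of order $8$, then $g$ and $g^3$ are representatives of the two conjugacy classes of elements of order $8$. (c) If $G=I^{*}$, these numbers are given by: $$\begin{array}{c|ccccccc} d & 1&2&3&4&5&6&10\\ \hline \nu(d)&1&1&20&30&24&20&24\\ r_0(d)&1&1&1&1&2&1&2\\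 r_1(d)&1&1&1&1&2&1&2\\ r_2(d)&1&1&1&1&1&1&1\end{array}$$ If $d=5$ (resp. $d=10$) and $g\in I^{*}$ is of order $d$, then $g$ and $g^2$ (resp. $g$ and $g^3$) are representatives of the two conjugacy classes of elements of order $d$.
   Context: $T^{*}$, $O^{*}$ and $I^{*}$ denote the binary tetrahedral, binary octahedral and binary icosahedral groups, of orders $24$, $48$ and $120$ respectively (the preimages in the unit quaternions of the rotation groups of the tetrahedron, octahedron and icosahedron). The group $O^{*}$ is generated by $X,P,Q,R$ subject to $X^3=1$, $P^2=Q^2=R^2$, $PQP^{-1}=Q^{-1}$, $XPX^{-1}=Q$, $XQX^{-1}=PQ$, $RXR^{-1}=X^{-1}$, $RPR^{-1}=QP$, $RQR^{-1}=Q^{-1}$, and $T^{*}$ is regarded as its index $2$ subgroup generated by $X,P,Q$ (with relations $X^3=1$, $P^2=Q^2$, $PQP^{-1}=Q^{-1}$, $XPX^{-1}=Q$, $XQX^{-1}=PQ$). *)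

(* Defs.v *)
From HB Require Import structures.
From mathcomp Require Import all_boot all_order all_algebra all_fingroup.
From mathcomp Require Import all_solvable.
From mathcomp Require Import boolp reals.
From mathcomp Require Import ring lra.

Set Implicit Arguments.
Unset Strict Implicit.
Unset Printing Implicit Defensive.

Import Order.TTheory GRing.Theory Num.Theory GroupScope.
Local Open Scope ring_scope.

Section ConjugacyCounts.
Variables (gT : finGroupType) (G : {group gT}).
Implicit Types (d : nat) (g h : gT).

Definition elements_of_order d : {set gT} := [set g in G | #[g]%g == d].

Definition num_elements d : nat := #|elements_of_order d|.

Definition classes_of_order d : {set {set gT}} :=
  [set (g ^: G)%g | g in elements_of_order d].

Definition num_classes d : nat := #|classes_of_order d|.

(* A :^: G is the set of all G-conjugates A :^ x of the set A; the pair is the *)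
(* singleton [set g] when g is its own inverse.                                *)
Definition num_inv_pair_classes d : nat :=
  #|[set ([set g; g^-1] :^: G)%g | g in elements_of_order d]|.

Definition num_cyclic_classes d : nat :=
  #|[set ((C : {set gT}) :^: G)%g | C : {group gT} in subgroups G
                                  & cyclic C && (#|C| == d)]|.

Definition two_class_reps d g h : Prop :=
  (g ^: G != h ^: G)%g /\ classes_of_order d = [set (g ^: G)%g; (h ^: G)%g].

End ConjugacyCounts.

Section Quaternions.
Variable R : realType.

(* Quat a b c d is a + b i + c j + d k *)
Record quat := Quat { qre : R; qi : R; qj : R; qk : R }.

Definition quat_tuple (q : quat) := (qre q, qi q, qj q, qk q).
Definition tuple_quat (t : R * R * R * R) := let: (a, b, c, d) := t in Quat a b c d.
Lemma quat_tupleK : cancel quat_tuple tuple_quat. Proof. by case. Qed.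
HB.instance Definition _ := Choice.copy quat (can_type quat_tupleK).

Definition quat_mul (p q : quat) : quat :=
  let: Quat a b c d := p in
  let: Quat a' b' c' d' := q in
  Quat (a * a' - b * b' - c * c' - d * d')
       (a * b' + b * a' + c * d' - d * c')
       (a * c' - b * d' + c * a' + d * b')
       (a * d' + b * c' - c * b' + d * a').

Definition quat_conj (q : quat) : quat :=
  let: Quat a b c d := q in Quat a (- b) (- c) (- d).

Definition quat_norm2 (q : quat) : R :=
  let: Quat a b c d := q in a ^+ 2 + b ^+ 2 + c ^+ 2 + d ^+ 2.

Lemma quat_mulA : associative quat_mul.
Proof. by move=> [? ? ? ?] [? ? ? ?] [? ? ? ?] /=; congr Quat; ring. Qed.

Lemma quat_norm2M p q :
  quat_norm2 (quat_mul p q) = quat_norm2 p * quat_norm2 q.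
Proof. by case: p q => [? ? ? ?] [? ? ? ?] /=; ring. Qed.

Lemma quat_norm2_conj q : quat_norm2 (quat_conj q) = quat_norm2 q.
Proof. by case: q => [? ? ? ?] /=; ring. Qed.

Lemma quat_mulqV q : quat_mul q (quat_conj q) = Quat (quat_norm2 q) 0 0 0.
Proof. by case: q => [? ? ? ?] /=; congr Quat; ring. Qed.

Lemma quat_mulVq q : quat_mul (quat_conj q) q = Quat (quat_norm2 q) 0 0 0.
Proof. by case: q => [? ? ? ?] /=; congr Quat; ring. Qed.

Record uquat := UQuat { uquat_val :> quat; _ : quat_norm2 uquat_val == 1 }.
HB.instance Definition _ := [isSub for uquat_val].
HB.instance Definition _ := [Choice of uquat by <:].

Lemma uquat_norm2 (q : uquat) : quat_norm2 q = 1.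
Proof. exact/eqP/(valP q). Qed.

Lemma uquat_one_subproof : quat_norm2 (Quat 1 0 0 0) == 1.
Proof. by apply/eqP => /=; ring. Qed.
Lemma uquat_mul_subproof (p q : uquat) : quat_norm2 (quat_mul p q) == 1.
Proof. by rewrite quat_norm2M !uquat_norm2 mulr1. Qed.
Lemma uquat_inv_subproof (q : uquat) : quat_norm2 (quat_conj q) == 1.
Proof. by rewrite quat_norm2_conj uquat_norm2. Qed.

Definition uquat_one := UQuat uquat_one_subproof.
Definition uquat_mul p q := UQuat (uquat_mul_subproof p q).
Definition uquat_inv q := UQuat (uquat_inv_subproof q).

Lemma uquat_mulA : associative uquat_mul.
Proof. by move=> p q r; apply/val_inj/quat_mulA. Qed.
Lemma uquat_mul1q : left_id uquat_one uquat_mul.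
Proof. by move=> [[? ? ? ?] ?]; apply: val_inj => /=; congr Quat; ring. Qed.
Lemma uquat_mulq1 : right_id uquat_one uquat_mul.
Proof. by move=> [[? ? ? ?] ?]; apply: val_inj => /=; congr Quat; ring. Qed.
Lemma uquat_mulVq : left_inverse uquat_one uquat_inv uquat_mul.
Proof. by move=> q; apply: val_inj; rewrite /= quat_mulVq uquat_norm2. Qed.
Lemma uquat_mulqV : right_inverse uquat_one uquat_inv uquat_mul.
Proof. by move=> q; apply: val_inj; rewrite /= quat_mulqV uquat_norm2. Qed.

HB.instance Definition _ := isGroup.Build uquat
  uquat_mulA uquat_mul1q uquat_mulq1 uquat_mulVq uquat_mulqV.

Definition mkv3 (x y z : R) : 'cV[R]_3 := \col_i [:: x; y; z]`_i.

Definition quat_of_v3 (v : 'cV[R]_3) : quat :=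
  Quat 0 (v 0 0) (v 1 0) (v 2%:R 0).
Definition v3_of_quat (q : quat) : 'cV[R]_3 := mkv3 (qi q) (qj q) (qk q).

(* The matrix of v |-> q v q^-1 on the pure quaternions, identified with R^3. *)
Definition rot (q : uquat) : 'M[R]_3 :=
  \matrix_(i, j) v3_of_quat
    (quat_mul (quat_mul q (quat_of_v3 (delta_mx j 0))) (quat_conj q)) i 0.

Definition SO3 : pred 'M[R]_3 := [pred A | (A *m A^T == 1%:M) && (\det A == 1)].

(* A polyhedron with at least one vertex outside every plane through the origin, *)
(* so that its rotation group is finite.                                         *)
Record polyhedron := Polyhedron {
  vertices : seq 'cV[R]_3;
  vertices_span : forall u : 'rV[R]_3,
    (forall v, v \in vertices -> u *m v = 0) -> u = 0 }.

Definition rotation_group (P : polyhedron) : pred 'M[R]_3 :=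
  [pred A | (A \in SO3) &&
            perm_eq [seq A *m v | v <- vertices P] (vertices P)].

Definition binary_group (P : polyhedron) : pred uquat :=
  [pred q | rot q \in rotation_group P].


Lemma v3P (u v : 'cV[R]_3) :
  u 0 0 = v 0 0 -> u 1 0 = v 1 0 -> u 2%:R 0 = v 2%:R 0 -> u = v.
Proof.
move=> h0 h1 h2; apply/matrixP => i j; rewrite [j]ord1.
by case: i => [[|[|[|//]]] lti]; [move: h0|move: h1|move: h2];
   congr (_ = _); congr (_ _ 0); apply: val_inj.
Qed.

Lemma mulmx_col3 (A : 'M[R]_3) (v : 'cV[R]_3) i :
  (A *m v) i 0 = A i 0 * v 0 0 + A i 1 * v 1 0 + A i 2%:R * v 2%:R 0.
Proof.
rewrite mxE !big_ord_recl big_ord0 addr0 addrA.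
by congr (_ * _ + _ * _ + _ * _); congr (_ _ _); apply: val_inj.
Qed.

Lemma rotE (q : uquat) (v : 'cV[R]_3) :
  rot q *m v =
  v3_of_quat (quat_mul (quat_mul q (quat_of_v3 v)) (quat_conj q)).
Proof.
by case: q => [[a b c d] hq]; apply: v3P;
   rewrite mulmx_col3 !mxE /= !mxE /=; ring.
Qed.

Lemma rotM (p q : uquat) : rot (p * q)%g = rot p *m rot q.
Proof.
have ext (A B : 'M[R]_3) : (forall v : 'cV_3, A *m v = B *m v) -> A = B.
  move=> AB; apply/matrixP => i j.
  by move/matrixP: (AB (delta_mx j 0)) => /(_ i 0); rewrite -!colE !mxE.
apply: ext => v; rewrite -mulmxA !rotE.
case: p q => [[a b c d] hp] [[a' b' c' d'] hq].
by apply: v3P; rewrite !mxE /= ?mxE /=; ring.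
Qed.

Lemma rot1 : rot 1%g = 1%:M.
Proof.
apply/matrixP => i j; rewrite !mxE /=.
by case: i => [[|[|[|//]]] lti]; case: j => [[|[|[|//]]] ltj];
   rewrite /= !mxE /=; ring.
Qed.

Lemma rotation_groupM P A B :
  A \in rotation_group P -> B \in rotation_group P ->
  A *m B \in rotation_group P.
Proof.
rewrite !inE => /andP[/andP[/eqP hA /eqP dA] pA] /andP[/andP[/eqP hB /eqP dB] pB].
rewrite det_mulmx dA dB mulr1 eqxx andbT; apply/andP; split.
  by rewrite trmx_mul mulmxA -(mulmxA A) hB mulmx1 hA.
rewrite (eq_map (fun v => esym (mulmxA A B v))) (map_comp (mulmx A) (mulmx B)).
exact: perm_trans (perm_map _ pB) pA.
Qed.

Lemma rotation_groupV P A B : A *m B = 1%:M ->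
  A \in rotation_group P -> B \in rotation_group P.
Proof.
move=> AB; rewrite !inE => /andP[/andP[/eqP hA /eqP dA] pA].
have BA : B *m A = 1%:M by apply: mulmx1C.
have BE : B = A^T by rewrite -[B]mulmx1 -hA mulmxA BA mul1mx.
rewrite {1 2 3}BE trmxK det_tr dA eqxx andbT -BE BA eqxx /=.
have := perm_map (mulmx B) pA; rewrite -map_comp perm_sym.
by rewrite [X in perm_eq _ X]map_id_in // => v _ /=; rewrite mulmxA BA mul1mx.
Qed.

Lemma binary_group_closed P : group_closed (binary_group P).
Proof.
split=> [|p q hp hq].
  rewrite inE /= rot1 !inE trmx1 mulmx1 det1 !eqxx /=.
  by rewrite (eq_map (_ : _ =1 id)) ?map_id // => v; rewrite mul1mx.
rewrite inE /= rotM; apply: rotation_groupM => //.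
by apply: rotation_groupV hq; rewrite -rotM mulgV rot1.
Qed.

Record binary (P : polyhedron) :=
  Binary { binary_val :> uquat; _ : binary_val \in binary_group P }.
HB.instance Definition _ P := [isSub for @binary_val P].
HB.instance Definition _ P := [Choice of binary P by <:].
HB.instance Definition _ P := SubChoice_isSubGroup.Build uquat (binary_group P)
  (binary P) (binary_group_closed P).

Lemma rot_eq1 (q : uquat) : rot q = 1%:M ->
  q = 1%g \/ uquat_val q = Quat (- 1) 0 0 0.
Proof.
case: q => [[a b c d] hq] h1.
have E (v : 'cV_3) : rot (UQuat hq) *m v = v by rewrite h1 mul1mx.
have := E (mkv3 1 0 0); rewrite rotE => /matrixP e1.
have := E (mkv3 0 1 0); rewrite rotE => /matrixP e2.
have := (e1 0 0, e1 1 0, e1 2%:R 0, e2 1 0); rewrite !mxE /= ?mxE /=.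
move=> [[[e11 e12] e13] e22]; have /= /eqP n1 := hq.
have cd : c ^+ 2 + d ^+ 2 = 0 by lra.
have bd : b ^+ 2 + d ^+ 2 = 0 by lra.
have sq0 (x y : R) : x ^+ 2 + y ^+ 2 = 0 -> x = 0 /\ y = 0.
  move/eqP; rewrite paddr_eq0 ?sqr_ge0 // !sqrf_eq0.
  by case/andP => /eqP -> /eqP ->.
have [c0 d0] := sq0 _ _ cd; have [b0 _] := sq0 _ _ bd; subst b c d.
have : a ^+ 2 = 1 by lra.
by move/eqP; rewrite sqrf_eq1 => /orP[]/eqP a1; [left; apply: val_inj|right]; rewrite /= a1.
Qed.

Lemma rot_eq (p q : uquat) : rot p = rot q ->
  p = q \/ uquat_val p = quat_mul (Quat (- 1) 0 0 0) q.
Proof.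
move=> pq; have /rot_eq1[|e] : rot (p * q^-1)%g = 1%:M.
- by rewrite rotM pq -rotM mulgV rot1.
- by move/(canRL (mulgVK _)); rewrite mul1g; left.
right; rewrite -e; have -> : quat_mul (p * q^-1)%g q = (p * q^-1 * q)%g by [].
by rewrite mulgVK.
Qed.

Section Finite.
Variable P : polyhedron.
Local Notation V := (vertices P).
Local Notation n := (size V).

Definition vertex_perm (q : binary P) : {ffun 'I_n -> 'I_n.+1} :=
  [ffun i => inord (index (rot q *m tnth (in_tuple V) i) V)].

Lemma vertex_perm_rot p q : vertex_perm p = vertex_perm q -> rot p = rot q.
Proof.
move=> /ffunP pq; apply/eqP; rewrite -subr_eq0; apply/eqP/row_matrixP => i.
rewrite row0; apply: (vertices_span (p := P)) => v vV.
rewrite -row_mul mulmxBl; suff -> : rot p *m v = rot q *m v by rewrite subrr row0.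
have inV (r : binary P) : rot r *m v \in V.
  have /andP[_ /perm_mem <-] := valP r; exact: map_f.
have lt_i : (index v V < n)%N by rewrite index_mem.
have := pq (Ordinal lt_i); rewrite !ffunE (tnth_nth 0) /= nth_index //.
move/(congr1 (@nat_of_ord _)); rewrite !inordK ?ltnS ?index_size // => e.
by rewrite -(nth_index 0 (inV p)) -(nth_index 0 (inV q)) e.
Qed.

Definition lift_of (q : binary P) : binary P :=
  choose [pred p | vertex_perm p == vertex_perm q] q.

Definition binary_code (q : binary P) := (vertex_perm q, q == lift_of q).

Lemma vertex_perm_lift q : vertex_perm (lift_of q) = vertex_perm q.
Proof.
apply/eqP; apply: (@chooseP _ [pred p | vertex_perm p == vertex_perm q]).
exact: eqxx.
Qed.

Lemma lift_of_eq p q : vertex_perm p = vertex_perm q -> lift_of p = lift_of q.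
Proof.
move=> e; rewrite /lift_of e; apply: choose_id; last exact: eqxx.
by apply/eqP.
Qed.

Lemma not_lift_of q : q != lift_of q ->
  uquat_val q = quat_mul (Quat (- 1) 0 0 0) (lift_of q).
Proof.
move=> q_ne; have /esym/vertex_perm_rot/rot_eq[e|//] := vertex_perm_lift q.
by case/eqP: q_ne; apply: val_inj.
Qed.

Lemma binary_code_inj : injective binary_code.
Proof.
move=> p q epq; have el := lift_of_eq (congr1 fst epq).
have := congr1 snd epq; rewrite /binary_code /snd.
have [p_eq /esym/eqP q_eq|p_ne /esym/negbT q_ne] := eqVneq p (lift_of p).
  by rewrite p_eq el -q_eq.
apply: val_inj; apply: val_inj.
by have := not_lift_of p_ne; rewrite el -(not_lift_of q_ne).
Qed.

Definition binary_decode (c : {ffun 'I_n -> 'I_n.+1} * bool) : option (binary P) :=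
  if pselect (exists q, binary_code q == c) is left h then Some (xchoose h) else None.

Lemma binary_codeK : pcancel binary_code binary_decode.
Proof.
move=> q; rewrite /binary_decode; case: pselect => [h|[]]; last by exists q.
by congr Some; apply: binary_code_inj; apply/eqP/(xchooseP h).
Qed.

End Finite.

HB.instance Definition _ P : isCountable (binary P) := PCanIsCountable (@binary_codeK P).
HB.instance Definition _ P : isFinite (binary P) := PCanIsFinite (@binary_codeK P).

Lemma mkv3_lform (u : 'rV[R]_3) x y z : u *m mkv3 x y z = 0 ->
  u 0 0 * x + u 0 1 * y + u 0 2%:R * z = 0.
Proof.
move/matrixP/(_ 0 0); rewrite !mxE !big_ord_recl big_ord0 addr0 addrA => e.
rewrite -[RHS]e !mxE /=; congr (_ * _ + _ * _ + _ * _); congr (u _ _);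
  exact: val_inj.
Qed.

Lemma rv3_eq0 (u : 'rV[R]_3) : u 0 0 = 0 -> u 0 1 = 0 -> u 0 2%:R = 0 -> u = 0.
Proof.
move=> h0 h1 h2; apply/trmx_inj/v3P; rewrite !mxE; [move: h0|move: h1|move: h2];
  by [].
Qed.

Definition tetrahedron_vertices : seq 'cV[R]_3 :=
  [:: mkv3 1 1 1; mkv3 1 (-1) (-1); mkv3 (-1) 1 (-1); mkv3 (-1) (-1) 1].

Lemma tetrahedron_span (u : 'rV[R]_3) :
  (forall v, v \in tetrahedron_vertices -> u *m v = 0) -> u = 0.
Proof.
move=> h; have := mkv3_lform (h (mkv3 1 1 1) _).
have := mkv3_lform (h (mkv3 1 (-1) (-1)) _).
have := mkv3_lform (h (mkv3 (-1) 1 (-1)) _).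
rewrite !inE !eqxx ?orbT => /(_ isT) h1 /(_ isT) h2 /(_ isT) h3.
by apply: rv3_eq0; lra.
Qed.

Definition tetrahedron := Polyhedron tetrahedron_span.

(* The midpoints of the edges of the tetrahedron above: with these coordinates T^* *)
(* is contained in O^*.                                                           *)
Definition octahedron_vertices : seq 'cV[R]_3 :=
  [:: mkv3 1 0 0; mkv3 (-1) 0 0; mkv3 0 1 0; mkv3 0 (-1) 0; mkv3 0 0 1;
      mkv3 0 0 (-1)].

Lemma octahedron_span (u : 'rV[R]_3) :
  (forall v, v \in octahedron_vertices -> u *m v = 0) -> u = 0.
Proof.
move=> h; have := mkv3_lform (h (mkv3 1 0 0) _).
have := mkv3_lform (h (mkv3 0 1 0) _).
have := mkv3_lform (h (mkv3 0 0 1) _).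
rewrite !inE !eqxx ?orbT => /(_ isT) h1 /(_ isT) h2 /(_ isT) h3.
by apply: rv3_eq0; lra.
Qed.

Definition octahedron := Polyhedron octahedron_span.

Definition golden : R := (1 + Num.sqrt 5) / 2.

Definition icosahedron_vertices : seq 'cV[R]_3 :=
  [:: mkv3 0 1 golden; mkv3 0 1 (- golden); mkv3 0 (-1) golden;
      mkv3 0 (-1) (- golden);
      mkv3 1 golden 0; mkv3 1 (- golden) 0; mkv3 (-1) golden 0;
      mkv3 (-1) (- golden) 0;
      mkv3 golden 0 1; mkv3 (- golden) 0 1; mkv3 golden 0 (-1);
      mkv3 (- golden) 0 (-1)].

Lemma icosahedron_span (u : 'rV[R]_3) :
  (forall v, v \in icosahedron_vertices -> u *m v = 0) -> u = 0.
Proof.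
move=> h; have := mkv3_lform (h (mkv3 0 1 golden) _).
have := mkv3_lform (h (mkv3 0 1 (- golden)) _).
have := mkv3_lform (h (mkv3 1 golden 0) _).
have := mkv3_lform (h (mkv3 1 (- golden) 0) _).
have := mkv3_lform (h (mkv3 golden 0 1) _).
have := mkv3_lform (h (mkv3 (- golden) 0 1) _).
rewrite !inE !eqxx ?orbT => /(_ isT) h1 /(_ isT) h2 /(_ isT) h3.
move=> /(_ isT) h4 /(_ isT) h5 /(_ isT) h6.
by apply: rv3_eq0; lra.
Qed.

Definition icosahedron := Polyhedron icosahedron_span.

Definition Tstar := binary tetrahedron.
Definition Ostar := binary octahedron.
Definition Istar := binary icosahedron.

(* See oct_generated and Tstar_generated below for generators. *)
Definition Tstar_in_Ostar : {set Ostar} :=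
  [set q : Ostar | binary_val q \in binary_group tetrahedron].

Lemma rot_SO3 (q : uquat) : SO3 (rot q).
Proof.
have trE : (rot q)^T = rot q^-1%g.
  case: q => [[a b c d] hq]; apply/matrixP => i j; rewrite !mxE /=.
  by case: i => [[|[|[|//]]] lti]; case: j => [[|[|[|//]]] ltj];
     rewrite /= !mxE /=; ring.
rewrite /SO3 /= trE -rotM mulgV rot1 eqxx /=; apply/eqP.
rewrite (expand_det_row _ 0) !big_ord_recl big_ord0 /cofactor.
rewrite !(expand_det_row _ 0) !big_ord_recl !big_ord0 /cofactor !det_mx11.
case: q trE => [[a b c d] hq] _; have /= /eqP n1 := hq.
rewrite !mxE /= !mxE /= ?expr0 ?expr1.
transitivity ((a ^+ 2 + b ^+ 2 + c ^+ 2 + d ^+ 2) ^+ 3); last by rewrite n1 expr1n.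
by ring.
Qed.

Lemma perm_nth (T : eqType) (x0 : T) (V : seq T) (s : seq nat) :
  perm_eq s (iota 0 (size V)) -> perm_eq [seq nth x0 V i | i <- s] V.
Proof. by move=> h; rewrite -{2}(mkseq_nth x0 V) perm_map. Qed.

Lemma sqrt2V : (Num.sqrt 2)^-1 ^+ 2 = 2^-1 :> R.
Proof. by rewrite exprVn sqr_sqrtr. Qed.

Lemma norm2X : quat_norm2 (Quat (- 2^-1) (- 2^-1) (- 2^-1) (- 2^-1)) == 1.
Proof. by apply/eqP => /=; field. Qed.
Lemma norm2P : quat_norm2 (Quat 0 1 0 0) == 1.
Proof. by apply/eqP => /=; ring. Qed.
Lemma norm2Q : quat_norm2 (Quat 0 0 1 0) == 1.
Proof. by apply/eqP => /=; ring. Qed.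
Lemma norm2R : quat_norm2 (Quat 0 (Num.sqrt 2)^-1 0 (- (Num.sqrt 2)^-1)) == 1.
Proof. by apply/eqP => /=; rewrite sqrrN !sqrt2V; field. Qed.


Lemma mkv3_eq (x y z x' y' z' : R) :
  x = x' -> y = y' -> z = z' -> mkv3 x y z = mkv3 x' y' z'.
Proof. by move=> -> -> ->. Qed.

Lemma rot_mkv3 (q : uquat) x y z : rot q *m mkv3 x y z =
  v3_of_quat (quat_mul (quat_mul q (Quat 0 x y z)) (quat_conj q)).
Proof. by rewrite rotE /quat_of_v3 !mxE. Qed.

Lemma binary_groupI P (q : uquat) (s : seq nat) :
  perm_eq s (iota 0 (size (vertices P))) ->
  [seq rot q *m v | v <- vertices P] = [seq nth 0 (vertices P) i | i <- s] ->
  q \in binary_group P.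
Proof. by move=> hs e; apply/andP; split; [exact: rot_SO3|rewrite e; exact: perm_nth]. Qed.

Lemma octX_subproof : UQuat norm2X \in binary_group octahedron.
Proof.
apply: (@binary_groupI _ _ [:: 2;3;4;5;0;1]%N) => //=.
by rewrite !rot_mkv3; do !congr cons; apply: mkv3_eq => /=; field.
Qed.
Lemma octP_subproof : UQuat norm2P \in binary_group octahedron.
Proof.
apply: (@binary_groupI _ _ [:: 0;1;3;2;5;4]%N) => //=.
by rewrite !rot_mkv3; do !congr cons; apply: mkv3_eq => /=; field.
Qed.
Lemma octQ_subproof : UQuat norm2Q \in binary_group octahedron.
Proof.
apply: (@binary_groupI _ _ [:: 1;0;2;3;5;4]%N) => //=.
by rewrite !rot_mkv3; do !congr cons; apply: mkv3_eq => /=; field.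
Qed.
Lemma octR_subproof : UQuat norm2R \in binary_group octahedron.
Proof.
apply: (@binary_groupI _ _ [:: 5;4;3;2;1;0]%N) => //=.
have := sqrt2V; set s := (Num.sqrt 2)^-1 => ss.
by rewrite !rot_mkv3; do !congr cons; apply: mkv3_eq => /=; lra.
Qed.

(* Generators of O^* satisfying the presentation
     X^3 = 1, P^2 = Q^2 = R^2, PQP^-1 = Q^-1, XPX^-1 = Q, XQX^-1 = PQ,
     RXR^-1 = X^-1, RPR^-1 = QP, RQR^-1 = Q^-1 :
   X = -(1+i+j+k)/2, P = i, Q = j, R = (i-k)/sqrt 2; X, P, Q generate T^*. *)
Definition octX : Ostar := Binary octX_subproof.
Definition octP : Ostar := Binary octP_subproof.
Definition octQ : Ostar := Binary octQ_subproof.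
Definition octR : Ostar := Binary octR_subproof.


Lemma Ostar_eq (p q : Ostar) : uquat_val p = uquat_val q -> p = q.
Proof. by move=> h; apply/val_inj/val_inj. Qed.

Lemma oct_relations :
  [/\ octX ^+ 3 = 1, octP ^+ 2 = octQ ^+ 2, octQ ^+ 2 = octR ^+ 2,
      octP * octQ * octP^-1 = octQ^-1 &
  [/\ octX * octP * octX^-1 = octQ, octX * octQ * octX^-1 = octP * octQ,
       octR * octX * octR^-1 = octX^-1, octR * octP * octR^-1 = octQ * octP &
       octR * octQ * octR^-1 = octQ^-1]]%g.
Proof.
have := sqrt2V; rewrite expr2 => ss.
rewrite !expgS !expg0 !mulg1.
by split; [..|split]; apply: Ostar_eq => /=; congr Quat; lra.
Qed.

Lemma mkv3_inj (x y z x' y' z' : R) :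
  mkv3 x y z = mkv3 x' y' z' -> [/\ x = x', y = y' & z = z'].
Proof.
by move/matrixP => e; have := (e 0 0, e 1 0, e 2%:R 0);
   rewrite !mxE /= => -[[-> ->] ->].
Qed.

Lemma binary_group_mem P (q : uquat) v :
  q \in binary_group P -> v \in vertices P -> rot q *m v \in vertices P.
Proof. by case/andP => _ /perm_mem pV vV; rewrite -pV; apply: map_f. Qed.

Lemma rot_binaryM P (p q : binary P) (v : 'cV[R]_3) :
  rot (p * q)%g *m v = rot p *m (rot q *m v).
Proof. by rewrite mulmxA -rotM. Qed.

Lemma binary_valM P (p q : binary P) :
  uquat_val (p * q)%g = quat_mul p q.
Proof. by []. Qed.

Lemma octahedron_to_e1 (w : 'cV[R]_3) (H : {group Ostar}) :
  octX \in H -> octQ \in H -> w \in octahedron_vertices ->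
  exists2 h : Ostar, h \in H & rot h *m w = mkv3 1 0 0.
Proof.
move=> HX HQ.
have X x y z : rot octX *m mkv3 x y z = mkv3 z x y.
  by rewrite rot_mkv3; apply: mkv3_eq => /=; field.
have Q x y z : rot octQ *m mkv3 x y z = mkv3 (- x) y (- z).
  by rewrite rot_mkv3; apply: mkv3_eq => /=; field.
rewrite !inE => /or4P[| | |/or3P[| |]] /eqP ->.
- by exists 1%g; rewrite ?group1 // [rot _]rot1 mul1mx.
- by exists octQ; rewrite // Q opprK !oppr0.
- by exists (octX * octX)%g; rewrite ?groupM // rot_binaryM !X.
- exists (octQ * (octX * octX))%g; first by rewrite !groupM.
  by rewrite !rot_binaryM !X Q opprK oppr0.
- by exists octX; rewrite // X.
- exists (octQ * octX)%g; first by rewrite groupM.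
  by rewrite rot_binaryM X Q opprK oppr0.
Qed.

Lemma octahedron_fix_e1 (q : Ostar) : rot q *m mkv3 1 0 0 = mkv3 1 0 0 ->
  qj q = 0 /\ qk q = 0.
Proof.
have := uquat_norm2 q; rewrite rot_mkv3.
case: (q : quat) => a b c d /= n1 /mkv3_inj[/= e _ _].
have : c ^+ 2 + d ^+ 2 = 0 by lra.
move/eqP; rewrite paddr_eq0 ?sqr_ge0 // !sqrf_eq0.
by case/andP => /eqP -> /eqP ->.
Qed.

Lemma Ostar_complex (q : Ostar) : qj q = 0 -> qk q = 0 ->
  uquat_val q = Quat (qre q) (qi q) 0 0.
Proof. by case: (uquat_val q) => a b c d /= -> ->. Qed.

Lemma octahedron_powP (q : Ostar) (H : {group Ostar}) : octP \in H ->
  qj q = 0 -> qk q = 0 -> qre q * qi q = 0 -> q \in H.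
Proof.
move=> HP c0 d0 /eqP; have qE := Ostar_complex c0 d0.
have := uquat_norm2 q; rewrite qE /=.
move: (qre q) (qi q) qE => a b qE n1; rewrite mulf_eq0 => /orP[]/eqP e.
  have : b ^+ 2 = 1 by rewrite e in n1; lra.
  move/eqP; rewrite sqrf_eq1 => /orP[]/eqP b1.
    by rewrite (_ : q = octP) //; apply: Ostar_eq; rewrite qE e b1.
  rewrite (_ : q = octP^-1)%g ?groupV //.
  by apply: Ostar_eq; rewrite qE e b1 /= oppr0.
have : a ^+ 2 = 1 by rewrite e in n1; lra.
move/eqP; rewrite sqrf_eq1 => /orP[]/eqP a1.
  by rewrite (_ : q = 1)%g ?group1 //; apply: Ostar_eq; rewrite qE e a1.
rewrite (_ : q = octP * octP)%g ?groupM //.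
by apply: Ostar_eq; rewrite qE e a1 /=; congr Quat; ring.
Qed.

Lemma Ostar_reduce (q : Ostar) (H : {group Ostar}) : octX \in H -> octQ \in H ->
  exists2 h, h \in H & rot (h * q)%g *m mkv3 1 0 0 = mkv3 1 0 0.
Proof.
move=> HX HQ; have e1V : mkv3 1 0 0 \in vertices octahedron by rewrite inE eqxx.
have [h hH fixh] := octahedron_to_e1 HX HQ (binary_group_mem (valP q) e1V).
by exists h; rewrite // rot_binaryM.
Qed.

Lemma Ostar_complex_rot (q : Ostar) x y z : qj q = 0 -> qk q = 0 ->
  rot q *m mkv3 x y z =
  mkv3 x ((qre q ^+ 2 - qi q ^+ 2) * y - 2 * (qre q * qi q) * z)
         ((qre q ^+ 2 - qi q ^+ 2) * z + 2 * (qre q * qi q) * y).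
Proof.
move=> c0 d0; have := uquat_norm2 q.
rewrite rot_mkv3 (Ostar_complex c0 d0) /= => n1.
apply: mkv3_eq => /=; [|ring..].
by rewrite -[RHS]mul1r -n1; ring.
Qed.

Lemma oct_generated : <<[set octX; octP; octQ; octR]>>%g = [set: Ostar].
Proof.
apply/eqP; rewrite eqEsubset subsetT /=; apply/subsetP => q _.
have := subset_gen [set octX; octP; octQ; octR].
set H := <<_>>%g; rewrite !subUset !sub1set -!andbA => /and4P[HX HP HQ HR].
have [h hH] := Ostar_reduce q HX HQ; rewrite -(groupMl _ hH).
move: (h * q)%g => {h hH}q fixq; have [c0 d0] := octahedron_fix_e1 fixq.
have [ab0|ab_n0] := eqVneq (qre q * qi q) 0.
  exact: (@octahedron_powP q <<_>>%G).
have ab : qre q ^+ 2 - qi q ^+ 2 = 0.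
  have /(binary_group_mem (valP q)) : mkv3 0 1 0 \in vertices octahedron.
    by rewrite !inE eqxx !orbT.
  rewrite Ostar_complex_rot // !inE => /or4P[| | |/or3P[| |]] /eqP/mkv3_inj[_ e e'];
    by [lra | case/eqP: ab_n0; lra].
pose h := (octQ * octX * octR)%g; have hH : h \in H by rewrite !groupM.
rewrite -(groupMl _ hH).
have hE : uquat_val h = Quat (Num.sqrt 2)^-1 (Num.sqrt 2)^-1 0 0.
  by rewrite !binary_valM /=; move: (Num.sqrt 2)^-1 => s; congr Quat; field.
have := binary_valM h q; rewrite hE (Ostar_complex c0 d0).
move: (h * q)%g => p pE; apply: (@octahedron_powP _ <<_>>%G) => //;
  rewrite pE /=; [ring..|].
rewrite (_ : _ * _ = (Num.sqrt 2)^-1 ^+ 2 * (qre q ^+ 2 - qi q ^+ 2)); last by ring.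
by rewrite ab mulr0.
Qed.

Lemma Tstar_generated : <<[set octX; octP; octQ]>>%g = Tstar_in_Ostar.
Proof.
have TX : octX \in Tstar_in_Ostar.
  rewrite inE; apply: (@binary_groupI _ _ [:: 0;2;3;1]%N) => //=.
  by rewrite !rot_mkv3; do !congr cons; apply: mkv3_eq => /=; field.
have TP : octP \in Tstar_in_Ostar.
  rewrite inE; apply: (@binary_groupI _ _ [:: 1;0;3;2]%N) => //=.
  by rewrite !rot_mkv3; do !congr cons; apply: mkv3_eq => /=; field.
have TQ : octQ \in Tstar_in_Ostar.
  rewrite inE; apply: (@binary_groupI _ _ [:: 2;3;0;1]%N) => //=.
  by rewrite !rot_mkv3; do !congr cons; apply: mkv3_eq => /=; field.
have gT : group_set (Tstar_in_Ostar).
  have [T1 TV] := binary_group_closed tetrahedron.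
  have TM := group_closedM (conj T1 TV).
  by apply/group_setP; split=> [|x y]; rewrite !inE //; apply: TM.
apply/eqP; rewrite eqEsubset (gen_subG _ (Group gT)) !subUset !sub1set TX TP TQ /=.
apply/subsetP => q Tq.
have := subset_gen [set octX; octP; octQ].
have sHT : <<[set octX; octP; octQ]>>%g \subset Group gT.
  by rewrite gen_subG !subUset !sub1set /= TX TP TQ.
move: sHT; set H := <<_>>%g => /subsetP sHT.
rewrite !subUset !sub1set -!andbA => /and3P[HX HP HQ].
have [h hH] := Ostar_reduce q HX HQ; rewrite -(groupMl _ hH).
have : (h * q)%g \in Group gT by rewrite groupM // sHT.
move: (h * q)%g => {h hH Tq}q; rewrite inE => Tq fixq.
have [c0 d0] := octahedron_fix_e1 fixq.
apply: (@octahedron_powP q <<_>>%G) => //.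
have /(binary_group_mem Tq) : mkv3 1 1 1 \in vertices tetrahedron by rewrite inE eqxx.
rewrite Ostar_complex_rot // !inE.
by case/or4P => /eqP/mkv3_inj[] *; lra.
Qed.

End Quaternions.

(* Main.v *)
(* A unit quaternion q is determined up to sign by the images of two vertices *)
(* under rot q, so each binary group is a list of 24, 48 or 120 quaternions   *)
(* with coordinates in Z[s] / 2, where s is sqrt 2 or the golden ratio. On    *)
(* this list products, orders and conjugates are computed. The elements of    *)
(* each order form at most two conjugacy classes, and the counts follow from  *)
(* which powers of a representative are conjugate to it.                      *)

Require Import Defs.
From mathcomp Require Import all_boot all_order all_algebra all_fingroup.
From mathcomp Require Import all_solvable reals.
From mathcomp Require Import ring lra.
(* Restores [rot], which burnside_app shadows. *)
Import Defs.

Set Implicit Arguments.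
Unset Strict Implicit.
Unset Printing Implicit Defensive.

Import Order.TTheory GRing.Theory Num.Theory.

(** Conjugation by a unit quaternion is a rotation, and a unit quaternion commuting with two
    independent pure quaternions is 1 or -1. Hence an element of a binary group is known up to sign
    from the images of two vertices, whose dot product it preserves. A list of elements of the
    group, closed under sign and reaching every pair of vertices with that dot product, is therefore
    the whole group ([binary_eval_surj]). As 1 and s are linearly independent over the integers,
    equality of quaternions is equality of integer coordinates, so these conditions are decided by
    evaluation and the group becomes computable ([binary_computes]).

    Each of r_0, r_1, r_2 counts the values of a class function on the elements of order d
    ([card_imset_two_reps]). If the classes of g and h cover these elements, the counts are 1 or 2
    according to whether h is conjugate to g, to g or g^-1, or to a generator of <g>. Where there
    are two classes, either h = g^k with k prime to d, so that r_2 = 1 and the k-th power map swaps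
    the classes ([power_reps_two_class]), or, for order 4 in O^*, all generators of <g> are
    conjugate to g and all three counts are 2 ([real_reps_counts]). *)

Section GroupTheory.
Local Open Scope group_scope.

(** * Class counts from one or two representatives *)

Section ConjugacyCounts.
Variables (gT : finGroupType) (G : {group gT}).
Implicit Types (d k : nat) (g h x : gT).

Definition class_counts d :=
  (num_elements G d, num_classes G d, num_inv_pair_classes G d, num_cyclic_classes G d).

Lemma mem_classes_of_order d g :
  g \in elements_of_order G d -> g ^: G \in classes_of_order G d.
Proof. exact: imset_f. Qed.

Lemma num_cyclic_classesE d :
  num_cyclic_classes G d =
  #|[set <[g]> :^: G | g in elements_of_order G d]|.
Proof.
congr #|pred_of_set _|; apply/setP => A; apply/imsetP/imsetP.
  case=> C; rewrite !inE => /and3P[sCG /cyclicP[g Cg] /eqP Cd] ->.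
  by exists g; rewrite ?Cg // inE -cycle_subG -Cg sCG /order -Cg Cd eqxx.
case=> g; rewrite !inE => /andP[gG /eqP gd] ->; exists <[g]>%G => //.
by rewrite !inE cycle_subG gG cycle_cyclic -gd eqxx.
Qed.

(* Each of the three kinds of classes is the image of a function constant on *)
(* conjugacy classes, so representatives of the latter suffice.              *)
Lemma card_imset_two_reps (rT : finType) (F : gT -> rT) d g h :
  (forall u v, v \in u ^: G -> F v = F u) ->
  g \in elements_of_order G d -> h \in elements_of_order G d ->
  elements_of_order G d \subset g ^: G :|: h ^: G ->
  #|F @: elements_of_order G d| = (F g != F h).+1.
Proof.
move=> FJ gd hd /subsetP sgh; rewrite -cards2; congr #|pred_of_set _|.
apply/eqP; rewrite eqEsubset; apply/andP; split; apply/subsetP => y.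
  by case/imsetP => x /sgh + ->; rewrite !inE => /orP[]/FJ->; rewrite eqxx ?orbT.
by rewrite !inE => /orP[]/eqP ->; apply: imset_f.
Qed.

Lemma conjugatesJ (A : {set gT}) x : x \in G -> (A :^ x) :^: G = A :^: G.
Proof.
move=> xG; apply/setP => B; apply/imsetP/imsetP => -[y yG ->].
  by exists (x * y); rewrite ?groupM // conjsgM.
by exists (x^-1 * y); rewrite ?groupM ?groupV // -conjsgM mulKVg.
Qed.

Lemma conjugates_eqP (A B : {set gT}) :
  A :^: G = B :^: G <-> exists2 x, x \in G & B = A :^ x.
Proof.
split=> [AB|[x xG ->]]; last by rewrite conjugatesJ.
have : B \in A :^: G by rewrite AB; apply/imsetP; exists 1; rewrite ?conjsg1.
by case/imsetP => x; exists x.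
Qed.

Lemma set_inv_pairJ g x : [set g ^ x; (g ^ x)^-1] = [set g; g^-1] :^ x.
Proof. by rewrite /conjugate imsetU !imset_set1 conjVg. Qed.

Lemma inv_pair_classJ g h : h \in g ^: G ->
  [set h; h^-1] :^: G = [set g; g^-1] :^: G.
Proof. by case/imsetP => x xG ->; rewrite set_inv_pairJ conjugatesJ. Qed.

Lemma cyclic_classJ g h : h \in g ^: G -> <[h]> :^: G = <[g]> :^: G.
Proof. by case/imsetP => x xG ->; rewrite cycleJ conjugatesJ. Qed.

Section TwoReps.
Variables (d : nat) (g h : gT).
Hypotheses (gd : g \in elements_of_order G d) (hd : h \in elements_of_order G d).
Hypothesis sgh : elements_of_order G d \subset g ^: G :|: h ^: G.

Lemma num_classes_two_reps : num_classes G d = (h \notin g ^: G).+1.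
Proof.
rewrite /num_classes (card_imset_two_reps _ gd hd sgh); last by move=> u v /class_eqP.
by rewrite eq_sym (sameP eqP class_eqP).
Qed.

Lemma num_inv_pair_classes_two_reps :
  num_inv_pair_classes G d = ((h \notin g ^: G) && (h \notin g^-1 ^: G)).+1.
Proof.
rewrite /num_inv_pair_classes (card_imset_two_reps _ gd hd sgh);
  last exact: inv_pair_classJ.
rewrite -negb_or /=; congr (~~ _).+1; apply/eqP/orP => [/conjugates_eqP[x xG e]|].
  have : h \in [set g; g^-1] :^ x by rewrite -e set21.
  rewrite -set_inv_pairJ !inE => /orP[]/eqP ->; [left|right].
    exact: memJ_class.
  by rewrite -conjVg memJ_class.
case=> /imsetP[x xG ->]; apply/conjugates_eqP; exists x; rewrite ?set_inv_pairJ //.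
by rewrite invgK setUC.
Qed.

Lemma num_cyclic_classes_two_reps :
  num_cyclic_classes G d = [forall k : 'I_d, coprime d k ==> (h \notin (g ^+ k) ^: G)].+1.
Proof.
rewrite num_cyclic_classesE (card_imset_two_reps _ gd hd sgh);
  last exact: cyclic_classJ.
have /setIdP[gG /eqP go] := gd; have /setIdP[hG /eqP ho] := hd.
have d_gt0 : 0 < d by rewrite -go order_gt0.
congr (nat_of_bool _).+1; apply/idP/forallP => [ne k|all_n].
  apply/implyP => dk; apply: contra ne => /imsetP[x xG e].
  apply/eqP/conjugates_eqP; exists x => //; rewrite e cycleJ; congr (_ :^ _).
  by apply/esym/eqP; rewrite [_ == _]generator_coprime go.
apply/eqP => /conjugates_eqP[x xG e].
have : h ^ x^-1 \in <[g]> by rewrite -mem_conjg -e cycle_id.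
case/cyclePmin => k; rewrite go => ltk hk.
(* This k is prime to d because the conjugate g^k of h generates <g>. *)
have := all_n (Ordinal ltk); rewrite -hk.
rewrite class_sym memJ_class ?groupV // implybF -{1}go -generator_coprime -hk.
by rewrite /generator cycleJ e conjsgK eqxx.
Qed.

End TwoReps.

Lemma one_class_counts d g :
  g \in elements_of_order G d -> elements_of_order G d \subset g ^: G ->
  (num_classes G d, num_inv_pair_classes G d, num_cyclic_classes G d) = (1, 1, 1)%N.
Proof.
(* A single class is the case h = g of two representatives. *)
move=> gd; rewrite -(setUid (g ^: G)) => sg.
rewrite /num_classes /classes_of_order /num_inv_pair_classes num_cyclic_classesE.
rewrite !(card_imset_two_reps _ gd gd sg) ?eqxx //.
- exact: inv_pair_classJ.
- by move=> u v /class_eqP.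
exact: cyclic_classJ.
Qed.

Lemma two_class_repsP d g h :
  g \in elements_of_order G d -> h \in elements_of_order G d ->
  elements_of_order G d \subset g ^: G :|: h ^: G -> h \notin g ^: G ->
  two_class_reps G d g h.
Proof.
move=> gd hd /subsetP sgh ngh; split.
  by apply: contra ngh => /eqP ->; apply: class_refl.
apply/eqP; rewrite eqEsubset; apply/andP; split; apply/subsetP => A.
  case/imsetP => x /sgh + ->; rewrite !inE => /orP[] /class_eqP ->;
  by rewrite eqxx ?orbT.
by rewrite !inE => /orP[]/eqP ->; apply: mem_classes_of_order.
Qed.

Lemma two_class_repsJ d g h g' h' : g' \in g ^: G -> h' \in h ^: G ->
  two_class_reps G d g h -> two_class_reps G d g' h'.
Proof. by move=> /class_eqP gg' /class_eqP hh'; rewrite /two_class_reps gg' hh'. Qed.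

Lemma two_class_repsC d g h :
  two_class_reps G d g h -> two_class_reps G d h g.
Proof. by rewrite /two_class_reps eq_sym setUC. Qed.

Lemma real_reps_counts d g h :
  g \in elements_of_order G d -> h \in elements_of_order G d ->
  elements_of_order G d \subset g ^: G :|: h ^: G -> h \notin g ^: G ->
  (forall k, k < d -> coprime d k -> g ^+ k \in g ^: G) ->
  (num_classes G d, num_inv_pair_classes G d, num_cyclic_classes G d) = (2, 2, 2)%N.
Proof.
move=> gd hd sgh ngh gX; have /setIdP[gG /eqP go] := gd.
have d_gt0 : 0 < d by rewrite -go order_gt0.
have gV : g^-1 \in g ^: G.
  by rewrite invg_expg go gX ?ltn_predL ?coprimenP.
rewrite (num_classes_two_reps gd hd sgh) (num_inv_pair_classes_two_reps gd hd sgh).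
rewrite (num_cyclic_classes_two_reps gd hd sgh) (class_eqP gV) ngh.
rewrite (_ : [forall k, _] = true) //; apply/forallP => k; apply/implyP => dk.
by rewrite (class_eqP (gX k _ dk)).
Qed.

Lemma expg_elements_of_order d k g : coprime d k ->
  g \in elements_of_order G d -> g ^+ k \in elements_of_order G d.
Proof.
move=> co_dk /setIdP[gG /eqP go].
by rewrite inE groupX //= orderXgcd go (eqP co_dk) divn1.
Qed.

Section PowerReps.
Variables (d k : nat) (g : gT).
Hypotheses (gd : g \in elements_of_order G d) (co_dk : coprime d k).
Hypothesis sg : elements_of_order G d \subset g ^: G :|: (g ^+ k) ^: G.
Hypothesis ngk : g ^+ k \notin g ^: G.

Lemma power_reps_counts :
  (num_classes G d, num_inv_pair_classes G d, num_cyclic_classes G d) =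
  (2, (g ^+ k \notin g^-1 ^: G).+1, 1)%N.
Proof.
have gkd := expg_elements_of_order co_dk gd; have /setIdP[_ /eqP go] := gd.
rewrite (num_classes_two_reps gd gkd sg) (num_inv_pair_classes_two_reps gd gkd sg) ngk.
rewrite num_cyclic_classesE (card_imset_two_reps _ gd gkd sg).
  have /eqP-> : <[g]> == <[g ^+ k]> by rewrite [_ == _]generator_coprime go.
  by rewrite eqxx.
exact: cyclic_classJ.
Qed.

(** As k is prime to d, the k-th power permutes the classes of elements of order d. It moves the
    class of g, hence swaps the two classes, whichever of them contains h. *)
Lemma power_reps_two_class h :
  h \in elements_of_order G d -> two_class_reps G d h (h ^+ k).
Proof.
have gkd := expg_elements_of_order co_dk gd; have /setIdP[_ /eqP go] := gd.
have gP := two_class_repsP gd gkd sg ngk.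
have pow_class x y m : y \in x ^: G -> y ^+ m \in (x ^+ m) ^: G.
  by case/imsetP => z zG ->; rewrite -conjXg memJ_class.
move=> hd; have := subsetP sg h hd; rewrite inE => /orP[hg|hgk].
  exact: two_class_repsJ (pow_class _ _ k hg) gP.
apply: two_class_repsC; apply: two_class_repsJ gP => //.
have hk := pow_class _ _ k hgk.
have := subsetP sg _ (expg_elements_of_order co_dk gkd); rewrite inE => /orP[/class_eqP gkk|gkk].
  by rewrite -gkk.
(* Raising g ^+ (k * k) ~ g ^+ k to the inverse of k modulo d gives g ^+ k ~ g. *)
case/negP: ngk; have /imsetP[z zG gz] := gkk.
have kK x : #[x] = d -> x ^+ k ^+ (egcdn k d).1 = x.
  move=> xd; rewrite -{2}(expgK (_ : coprime #|<[x]>| k) (cycle_id x)) -?orderE ?xd //.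
  by rewrite /expg_invn -orderE xd.
have gko : #[g ^+ k] = d by have /setIdP[_ /eqP] := gkd.
by rewrite -(kK _ gko) gz -conjXg kK // memJ_class.
Qed.

End PowerReps.
End ConjugacyCounts.

(* A finite group copied on a list L of elements of a datatype M on which the *)
(* operations compute.                                                        *)
Record computes (gT : finGroupType) (M : eqType) (e : M) (mul : M -> M -> M)
    (inv : M -> M) (L : seq M) (el : M -> gT) : Prop := Computes {
  computes_uniq : uniq L;
  computes_e : e \in L;
  computes_mul : forall x y, x \in L -> y \in L -> mul x y \in L;
  computes_inv : forall x, x \in L -> inv x \in L;
  el_inj : {in L &, injective el};
  el_surj : forall g, exists2 x, x \in L & g = el x;
  el1 : el e = 1;
  elM : forall x y, x \in L -> y \in L -> el (mul x y) = el x * el y;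
  elV : forall x, x \in L -> el (inv x) = (el x)^-1 }.

(** * Orders, conjugacy and class counts decided on a list *)

Section Compute.
Variables (M : eqType) (e : M) (mul : M -> M -> M) (inv : M -> M) (L : seq M).

Definition conjugate_seq x := [seq mul (inv h) (mul x h) | h <- L].

(* Exceeds the orders of the elements of T^*, O^* and I^*. *)
Definition order_bound := 12.
(** The trajectory starts at x, so index i holds the power i + 1. If [e] is not found, the value is
    [order_bound] + 1, which the bounds assumed below exclude. *)
Definition seq_order x := (find (pred1 e) (traject (mul x) x order_bound)).+1.

Definition order_seq d := [seq x <- L | seq_order x == d].

Variables (gT : finGroupType) (el : M -> gT).
Hypothesis cp : computes e mul inv L el.

Lemma mem_conjugate_seq x y : x \in L -> y \in L ->
  (el y \in el x ^: [set: gT]) = (y \in conjugate_seq x).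
Proof.
move=> xL yL; have J h : h \in L -> el (mul (inv h) (mul x h)) = el x ^ el h.
  have mL := computes_mul cp; have iL := computes_inv cp.
  by move=> hL; rewrite !(elM cp) ?(elV cp) ?mL ?iL // conjgE.
apply/imsetP/mapP => [[g _]|[h hL ->]]; last by exists (el h); rewrite ?J.
have [h hL ->] := el_surj cp g; rewrite -J // => e1; exists h => //.
by apply: (el_inj cp) e1 => //; rewrite !(computes_mul cp, computes_inv cp).
Qed.

Lemma order_el x : x \in L -> seq_order x <= order_bound ->
  #[el x] = seq_order x.
Proof.
move=> xL; rewrite /seq_order; set s := traject _ _ _ => lt_s.
have iterL k : iter k (mul x) x \in L.
  by elim: k => //= k IH; apply: (computes_mul cp).
have el_iter k : el (iter k (mul x) x) = el x ^+ k.+1.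
  by elim: k => [|k IH] /=; rewrite ?expg1 // (elM cp) // IH -expgS.
have size_s : size s = order_bound by rewrite size_traject.
have nth_s k : k < order_bound -> nth x s k = iter k (mul x) x.
  by move=> ltk; rewrite nth_traject.
have has_s : has (pred1 e) s by rewrite has_find size_s.
have /eqP := nth_find x has_s; rewrite nth_s // => /(congr1 el).
rewrite el_iter (el1 cp) => /eqP; rewrite -order_dvdn => /dvdn_leq le_o.
(* A smaller order would, by injectivity of [el], put [e] in the trajectory before its first
   occurrence. *)
apply/eqP; rewrite eqn_leq le_o //= ltnNge; apply/negP => lt_o.
have o_gt0 := order_gt0 (el x); have lt_p : (#[el x].-1 < find (pred1 e) s)%N.
  by rewrite -ltnS prednK.
have /negP[] := before_find x lt_p.
rewrite /= nth_s ?(ltn_trans lt_p) //; apply/eqP/(el_inj cp); rewrite ?iterL //.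
  exact: computes_e cp.
by rewrite el_iter (el1 cp) prednK // expg_order.
Qed.

Hypothesis ord_le : all (fun x => seq_order x <= order_bound) L.

Lemma elements_of_order_el d x : x \in L ->
  (el x \in elements_of_order [set: gT] d) = (x \in order_seq d).
Proof. by move=> xL; rewrite mem_filter xL !inE order_el ?(allP ord_le) ?andbT. Qed.

Lemma num_elements_el d : num_elements [set: gT] d = size (order_seq d).
Proof.
have injL : {in order_seq d &, injective el}.
  move=> x y; rewrite !mem_filter => /andP[_ xL] /andP[_ yL]; exact: (el_inj cp).
rewrite -(size_map el) -(card_uniqP _) ?map_inj_in_uniq ?filter_uniq ?(computes_uniq cp) //.
apply: eq_card => g; have [x xL ->] := el_surj cp g.
rewrite [LHS]elements_of_order_el //; apply/idP/mapP => [|[y yd e1]]; first by exists x.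
have yL : y \in L by move: yd; rewrite mem_filter => /andP[].
by rewrite (el_inj cp xL yL e1).
Qed.

Lemma sub_elements_of_order d (s : seq M) (A : {set gT}) :
  all [in s] (order_seq d) ->
  (forall x, x \in L -> x \in s -> el x \in A) ->
  elements_of_order [set: gT] d \subset A.
Proof.
move=> /allP sd sA; apply/subsetP => g; have [x xL ->] := el_surj cp g.
by rewrite elements_of_order_el // => /sd; apply: sA.
Qed.

Definition seq_pow x k := iter k (mul x) e.

Lemma seq_powP x k : x \in L -> seq_pow x k \in L /\ el (seq_pow x k) = el x ^+ k.
Proof.
move=> xL; elim: k => [|k [kL IH]]; first by rewrite (computes_e cp) (el1 cp).
by rewrite expgS -IH /= (computes_mul cp) ?(elM cp).
Qed.

Definition one_class d x := (x \in order_seq d) && all [in conjugate_seq x] (order_seq d).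

Definition two_classes d x y :=
  [&& x \in order_seq d, y \in order_seq d, y \notin conjugate_seq x &
      all [in conjugate_seq x ++ conjugate_seq y] (order_seq d)].

Lemma order_seqP d x : x \in order_seq d ->
  x \in L /\ el x \in elements_of_order [set: gT] d.
Proof.
move=> xd; have := xd; rewrite mem_filter => /andP[_ xL].
by rewrite elements_of_order_el.
Qed.

Lemma order_seq_nil (ds : seq nat) d :
  all (fun x => seq_order x \in ds) L -> d \notin ds -> order_seq d = [::].
Proof.
move=> /allP ordL nd; apply/eqP; rewrite -size_eq0 size_filter -leqn0 leqNgt -has_count.
by apply/hasPn => x /ordL xd; apply: contraNneq nd => <-.
Qed.

Lemma no_class_counts_el d : order_seq d = [::] ->
  class_counts [set: gT]%G d = (0, 0, 0, 0)%N.
Proof.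
move=> d0; have := num_elements_el d; rewrite d0 => n0.
rewrite /class_counts n0; move/eqP: n0; rewrite cards_eq0 => /eqP n0.
rewrite num_cyclic_classesE /num_classes /classes_of_order /num_inv_pair_classes n0.
by rewrite !imset0 !cards0.
Qed.

Lemma one_class_counts_el d x : one_class d x ->
  class_counts [set: gT]%G d = (size (order_seq d), 1, 1, 1)%N.
Proof.
case/andP=> /order_seqP[xL xd] dx; rewrite /class_counts num_elements_el.
have sx : elements_of_order [set: gT] d \subset el x ^: [set: gT].
  by apply: sub_elements_of_order dx _ => y yL; rewrite mem_conjugate_seq.
by have [-> -> ->] := one_class_counts xd sx.
Qed.

Lemma two_classesP d x y : two_classes d x y ->
  [/\ x \in L /\ el x \in elements_of_order [set: gT] d,
      y \in L /\ el y \in elements_of_order [set: gT] d,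
      el y \notin el x ^: [set: gT] &
      elements_of_order [set: gT] d \subset el x ^: [set: gT] :|: el y ^: [set: gT]].
Proof.
case/and4P=> /order_seqP[xL xd] /order_seqP[yL yd] nyx dxy; split=> //.
  by rewrite mem_conjugate_seq.
apply: sub_elements_of_order dxy _ => z zL.
by rewrite mem_cat inE !mem_conjugate_seq.
Qed.

Lemma two_class_reps_el d x y : two_classes d x y ->
  two_class_reps [set: gT] d (el x) (el y).
Proof. by case/two_classesP => -[_ xd] [_ yd] nyx dxy; apply: two_class_repsP. Qed.

Lemma power_reps_el d k x : coprime d k -> two_classes d x (seq_pow x k) ->
  class_counts [set: gT]%G d =
  (size (order_seq d), 2, (seq_pow x k \notin conjugate_seq (inv x)).+1, 1)%N
  /\ forall g, #[g] = d -> two_class_reps [set: gT] d g (g ^+ k).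
Proof.
move=> dk /two_classesP[[xL xd] [pL _]]; have [_ ->] := seq_powP k xL.
move=> nyx dxy; split=> [|g gd].
  have [e1 e2 e3] := power_reps_counts xd dk dxy nyx.
  rewrite /class_counts e1 e2 e3 num_elements_el.
  rewrite -mem_conjugate_seq ?(computes_inv cp) // (elV cp) //.
  by have [_ ->] := seq_powP k xL.
by apply: (power_reps_two_class xd dk dxy nyx); rewrite !inE gd eqxx.
Qed.

Lemma real_reps_el d x y : two_classes d x y ->
  all (fun k => coprime d k ==> (seq_pow x k \in conjugate_seq x)) (iota 0 d) ->
  class_counts [set: gT]%G d = (size (order_seq d), 2, 2, 2)%N.
Proof.
case/two_classesP=> -[xL xd] [yL yd] nyx dxy /allP powx.
have real_x k : k < d -> coprime d k -> el x ^+ k \in el x ^: [set: gT].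
  move=> ltk dk; have [kL <-] := seq_powP k xL.
  rewrite mem_conjugate_seq //; apply: implyP dk.
  by apply: powx; rewrite mem_iota.
by rewrite /class_counts num_elements_el; have [-> -> ->] := real_reps_counts xd yd dxy nyx real_x.
Qed.

End Compute.
End GroupTheory.

(** * Integer arithmetic for quaternions with coordinates in Z[s] / 2 *)

Section Quaternions.
Local Open Scope ring_scope.

(* The pair (a, b) stands for a + b s, where s ^ 2 = n + t s. *)
Definition qint : Type := int * int.
Definition iquat : Type := qint * qint * qint * qint.
Definition ivec : Type := qint * qint * qint.

Section IntegerQuaternions.
Variables t n : int.

Definition qint_add (x y : qint) : qint := (x.1 + y.1, x.2 + y.2).
Definition qint_opp (x : qint) : qint := (- x.1, - x.2).
Definition qint_mul (x y : qint) : qint :=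
  (x.1 * y.1 + n * (x.2 * y.2), x.1 * y.2 + x.2 * y.1 + t * (x.2 * y.2)).

Definition iquat_mul (p q : iquat) : iquat :=
  let: (a, b, c, d) := p in
  let: (a', b', c', d') := q in
  let add := qint_add in
  let sub x y := qint_add x (qint_opp y) in
  let mul := qint_mul in
  (sub (sub (sub (mul a a') (mul b b')) (mul c c')) (mul d d'),
   sub (add (add (mul a b') (mul b a')) (mul c d')) (mul d c'),
   add (add (sub (mul a c') (mul b d')) (mul c a')) (mul d b'),
   add (sub (add (mul a d') (mul b c')) (mul c b')) (mul d a')).

Definition iquat_conj (p : iquat) : iquat :=
  let: (a, b, c, d) := p in (a, qint_opp b, qint_opp c, qint_opp d).

Definition iquat_map (f : int -> int) (p : iquat) : iquat :=
  let: (a, b, c, d) := p in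
  let g (x : qint) : qint := (f x.1, f x.2) in (g a, g b, g c, g d).

Definition iquat_opp (p : iquat) : iquat :=
  let: (a, b, c, d) := p in (qint_opp a, qint_opp b, qint_opp c, qint_opp d).

Definition int_half (x : int) : int :=
  match x with Posz k => Posz k./2 | Negz k => Negz k./2 end.

(* An iquat p encodes the quaternion p / 2; the product of p / 2 and q / 2 is *)
(* then encoded by p q / 2 when this is integral.                             *)
Definition hmul (p q : iquat) : iquat := iquat_map int_half (iquat_mul p q).
Definition hone : iquat := ((2, 0), (0, 0), (0, 0), (0, 0)).

Definition pure (v : ivec) : iquat := let: (x, y, z) := v in ((0, 0), x, y, z).

(** With h standing for h / 2, the rotation sends v to h v h^* / 4; comparing h v h^* with 4 w
    avoids the division. *)
Definition quadruple : iquat -> iquat := iquat_map (fun x => x + x + (x + x)).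

Definition ivec_rot (h : iquat) (v : ivec) : iquat :=
  iquat_mul (iquat_mul h (pure v)) (iquat_conj h).

Definition ivec_dot (v w : ivec) : qint :=
  let: (x, y, z) := v in
  let: (x', y', z') := w in
  qint_add (qint_add (qint_mul x x') (qint_mul y y')) (qint_mul z z').

(** One coordinate of the cross product; when it is nonzero, v and w are independent. *)
Definition ivec_minor (v w : ivec) : qint :=
  let: (x, y, z) := v in
  let: (x', y', z') := w in
  qint_add (qint_mul x y') (qint_opp (qint_mul y x')).

(** The last condition says that h / 2 has norm 1. Closure under products is derived in
    [binary_computes] rather than tested on all pairs. *)
Definition iquat_closed (L : seq iquat) : bool :=
  [&& uniq L, hone \in L, all (fun h => iquat_conj h \in L) L,
      all (fun h => iquat_opp h \in L) L &
      all (fun h => iquat_mul h (iquat_conj h) == iquat_mul hone hone) L].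

Definition iquat_preserves (L : seq iquat) (V : seq ivec) : bool :=
  let V4 := [seq quadruple (pure v) | v <- V] in
  uniq V && all (fun h => all (fun v => ivec_rot h v \in V4) V) L.

Definition iquat_transitive (L : seq iquat) (V : seq ivec) (v w : ivec) : bool :=
  let Lvw := [seq (ivec_rot h v, ivec_rot h w) | h <- L] in
  let quad p := (quadruple (pure p.1), quadruple (pure p.2)) in
  [&& v \in V, w \in V, ivec_minor v w != (0, 0) &
      all [in Lvw] [seq quad p | p <- [seq (v', w') | v' <- V, w' <- V]
                               & ivec_dot p.1 p.2 == ivec_dot v w]].

End IntegerQuaternions.

(** * Evaluation of the integer model in the real quaternions *)

Section Evaluation.
Variables (R : realType) (t n : int) (s : R).
Hypothesis s2 : s ^+ 2 = n%:~R + t%:~R * s.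
Hypothesis s_free : forall a b : int, a%:~R + b%:~R * s = 0 -> a = 0 /\ b = 0.

Definition qint_eval (x : qint) : R := x.1%:~R + x.2%:~R * s.
Local Notation ev := qint_eval.

Lemma qint_evalD x y : ev (qint_add x y) = ev x + ev y.
Proof. by rewrite /ev /= !rmorphD /=; ring. Qed.
Lemma qint_evalN x : ev (qint_opp x) = - ev x.
Proof. by rewrite /ev /= !rmorphN /=; ring. Qed.
Lemma qint_evalM x y : ev (qint_mul t n x y) = ev x * ev y.
Proof.
transitivity (x.1%:~R * y.1%:~R + (x.1%:~R * y.2%:~R + x.2%:~R * y.1%:~R) * s
  + x.2%:~R * y.2%:~R * s ^+ 2); last by rewrite /ev; ring.
by rewrite s2 /ev /= !(rmorphD, rmorphM) /=; ring.
Qed.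

Lemma qint_eval_inj : injective ev.
Proof.
move=> [a b] [a' b'] /eqP; rewrite -subr_eq0 => /eqP e.
have /s_free[/eqP + /eqP] : (a - a')%:~R + (b - b')%:~R * s = 0.
  by rewrite -e /ev /= !rmorphB /=; ring.
by rewrite !subr_eq0 => /eqP-> /eqP->.
Qed.

Lemma qint_eval0 : ev (0, 0) = 0.
Proof. by rewrite /ev mul0r addr0. Qed.

Definition qint_evalE := (qint_evalD, qint_evalN, qint_evalM, qint_eval0).

Definition iquat_eval (p : iquat) : quat R :=
  let: (a, b, c, d) := p in Quat (ev a) (ev b) (ev c) (ev d).
Definition half_eval (p : iquat) : quat R :=
  let: (a, b, c, d) := p in Quat (ev a / 2) (ev b / 2) (ev c / 2) (ev d / 2).

Lemma iquat_evalM p q :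
  iquat_eval (iquat_mul t n p q) = quat_mul (iquat_eval p) (iquat_eval q).
Proof.
move: p q => [[[? ?] ?] ?] [[[? ?] ?] ?] /=.
by rewrite !qint_evalE.
Qed.

Lemma iquat_eval_conj p : iquat_eval (iquat_conj p) = quat_conj (iquat_eval p).
Proof. by move: p => [[[? ?] ?] ?] /=; rewrite !qint_evalE. Qed.

Lemma half_eval_conj p : half_eval (iquat_conj p) = quat_conj (half_eval p).
Proof. by move: p => [[[? ?] ?] ?] /=; rewrite !qint_evalE !mulNr. Qed.

Lemma iquat_eval_inj : injective iquat_eval.
Proof.
by move=> [[[? ?] ?] ?] [[[? ?] ?] ?] [] /= *; do !congr pair; apply: qint_eval_inj.
Qed.

Lemma half_eval_inj : injective half_eval.
Proof.
have half_inj (x y : R) : x / 2 = y / 2 -> x = y by move=> ?; lra.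
by move=> [[[? ?] ?] ?] [[[? ?] ?] ?] [] /= *; do !congr pair;
   apply/qint_eval_inj/half_inj.
Qed.

Lemma int_halfK : cancel (fun x : int => x + x) int_half.
Proof.
case=> k; first by rewrite /= addnn doubleK.
by rewrite -[_ + _]/(Negz (k + k).+1) /= addnn uphalf_double.
Qed.

(** Injectivity of evaluation forces the integer product to be r + r, so the halving in [hmul] is
    exact once the product is known to have an encoding. *)
Lemma half_evalM p q r :
  quat_mul (half_eval p) (half_eval q) = half_eval r -> hmul t n p q = r.
Proof.
move=> e; rewrite /hmul.
have -> : iquat_mul t n p q = iquat_map (fun x => x + x) r.
  apply: iquat_eval_inj; rewrite iquat_evalM.
  move: p q r e => [[[a b] c] d] [[[a' b'] c'] d'] [[[x y] z] w] /=.
  have ev2 u : ev (u.1 + u.1, u.2 + u.2) = ev u * 2.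
    by rewrite /ev /= !rmorphD /=; ring.
  rewrite !ev2 => -[e1 e2 e3 e4].
  by congr Quat; lra.
by move: r {e} => [[[[? ?] [? ?]] [? ?]] [? ?]] /=; rewrite !int_halfK.
Qed.

Definition ivec_eval (v : ivec) : 'cV[R]_3 :=
  let: (x, y, z) := v in mkv3 (ev x) (ev y) (ev z).

Lemma ivec_eval_inj : injective ivec_eval.
Proof.
by move=> [[? ?] ?] [[? ?] ?] /mkv3_inj[] /= *; do !congr pair; apply: qint_eval_inj.
Qed.

Lemma rot_half_eval (q : uquat R) h v w : uquat_val q = half_eval h ->
  (rot q *m ivec_eval v == ivec_eval w) = (ivec_rot t n h v == quadruple (pure w)).
Proof.
move=> qh; have -> : rot q *m ivec_eval v = v3_of_quat (quat_mul (quat_mul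
    (half_eval h) (iquat_eval (pure v))) (quat_conj (half_eval h))).
  by case: v => [[x y] z]; rewrite [ivec_eval _]/= rot_mkv3 qh /= qint_eval0.
rewrite -half_eval_conj; have quarter : quat_mul (quat_mul (half_eval h)
    (iquat_eval (pure v))) (half_eval (iquat_conj h)) =
    let: Quat a b c d := iquat_eval (ivec_rot t n h v) in
    Quat (a / 4) (b / 4) (c / 4) (d / 4).
  rewrite /ivec_rot !iquat_evalM.
  move: h (iquat_conj h) (pure v) {qh} => [[[? ?] ?] ?] [[[? ?] ?] ?] [[[? ?] ?] ?] /=.
  by congr Quat; field.
have ev4 (x : qint) : ev (x.1 + x.1 + (x.1 + x.1), x.2 + x.2 + (x.2 + x.2)) = ev x * 4.
  by rewrite /ev /= !rmorphD /=; ring.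
(* [v3_of_quat] forgets the real part, but the integer test compares it; conjugates of pure
   quaternions are pure. *)
have re0 : (ivec_rot t n h v).1.1.1 = (0, 0).
  apply: qint_eval_inj; rewrite qint_eval0.
  rewrite [LHS](_ : _ = qre (iquat_eval (ivec_rot t n h v))); last first.
    by case: (ivec_rot _ _ _ _) => [[[]]].
  rewrite /ivec_rot !iquat_evalM iquat_eval_conj.
  case: h v {qh quarter} => [[[? ?] ?] ?] [[? ?] ?] /=; rewrite qint_eval0; ring.
rewrite quarter; case: (ivec_rot _ _ _ _) re0 => [[[a b] c] d] /= ->.
case: w => [[x y] z]; apply/eqP/eqP => [/mkv3_inj[]|] /=.
  by move=> e1 e2 e3; do !congr pair; apply: qint_eval_inj; rewrite ev4; lra.
by case=> -> -> ->; rewrite !ev4; apply: mkv3_eq => /=; field.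
Qed.

Lemma rot_dot (q : uquat R) v w v' w' :
  rot q *m ivec_eval v = ivec_eval v' -> rot q *m ivec_eval w = ivec_eval w' ->
  ivec_dot t n v' w' = ivec_dot t n v w.
Proof.
have dotE x y : (ivec_eval x)^T *m ivec_eval y = (ev (ivec_dot t n x y))%:M.
  apply/matrixP => i j; rewrite !ord1 !mxE !big_ord_recl big_ord0 !mxE /=.
  by case: x y => [[x y] z] [[x' y'] z'] /=; rewrite !mxE !qint_evalE /=; ring.
move=> ev' ew'; apply: qint_eval_inj.
have /andP[/eqP/mulmx1C rT _] := rot_SO3 q.
have /matrixP/(_ 0 0) :
    (ev (ivec_dot t n v' w'))%:M = (ev (ivec_dot t n v w))%:M :> 'M[R]_1.
  by rewrite -!dotE -ev' -ew' trmx_mul mulmxA -(mulmxA _ _ (rot q)) rT mulmx1.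
by rewrite !mxE.
Qed.

(** Fixing a vector means commuting with it, so the imaginary part of q is parallel to both v and w.
    These are independent, so it vanishes, and the norm leaves 1 and -1. *)
Lemma rot_fix2 (q : uquat R) v w : ivec_minor t n v w != (0, 0) ->
  rot q *m ivec_eval v = ivec_eval v -> rot q *m ivec_eval w = ivec_eval w ->
  uquat_val q = Quat 1 0 0 0 \/ uquat_val q = Quat (- 1) 0 0 0.
Proof.
have comm (x y z : R) : rot q *m mkv3 x y z = mkv3 x y z ->
    quat_mul q (Quat 0 x y z) = quat_mul (Quat 0 x y z) q.
  rewrite rot_mkv3; set u := Quat 0 x y z => fix_u.
  have E : quat_mul (quat_mul q u) (quat_conj q) = u.
    move: fix_u; rewrite /u; case: (uquat_val q) => a b c d /= /mkv3_inj[] /=.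
    by move=> e1 e2 e3; congr Quat => //; ring.
  rewrite -{2}E -(quat_mulA _ (quat_conj q)) quat_mulVq uquat_norm2.
  by case: (quat_mul q u) => a b c d /=; congr Quat; ring.
move: v w => [[x y] z] [[x' y'] z'] /=.
rewrite -(inj_eq qint_eval_inj) !qint_evalE => minor /comm + /comm.
have := uquat_norm2 q.
move: minor; move: (ev x) (ev y) (ev z) (ev x') (ev y') (ev z').
move=> {}x {}y {}z {}x' {}y' {}z' minor.
case: (uquat_val q) => a b c d /= n1 [_ e1 e2 e3] [_ e1' e2' e3'].
have minor0 (k : R) : k * (x * y' - y * x') = 0 -> k = 0.
  by move/eqP; rewrite mulf_eq0 (negPf minor) orbF => /eqP.
have h1 : b * y = c * x by lra.
have h2 : b * y' = c * x' by lra.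
(* Cramer's rule, with the nonzero minor as determinant. *)
have b0 : b = 0.
  apply: minor0; transitivity (x * (b * y') - x' * (b * y)); first by ring.
  by rewrite h1 h2; ring.
have c0 : c = 0.
  apply: minor0; transitivity (y' * (c * x) - y * (c * x')); first by ring.
  by rewrite -h1 -h2; ring.
subst b c; have [h3 h4] : d * y' = 0 /\ d * x' = 0 by lra.
have d0 : d = 0.
  apply: minor0; transitivity (x * (d * y') - y * (d * x')); first by ring.
  by rewrite h3 h4; ring.
subst d; have : a ^+ 2 = 1 by lra.
by move/eqP; rewrite sqrf_eq1 => /orP[]/eqP->; [left|right].
Qed.

(** * The list exhausts the binary group *)

Section Group.
Variables (P : polyhedron R) (V : seq ivec) (L : seq iquat) (v0 w0 : ivec).
Hypothesis VE : vertices P = map ivec_eval V.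
Hypothesis Lclosed : iquat_closed t n L.
Hypothesis Lpres : iquat_preserves t n L V.
Hypothesis Ltrans : iquat_transitive t n L V v0 w0.

(* 1 when half_eval h is not in the group. *)
Definition binary_eval (h : iquat) : binary P :=
  insubd (1%g : binary P) (insubd (1%g : uquat R) (half_eval h)).

Lemma mem_vertices v : (ivec_eval v \in vertices P) = (v \in V).
Proof. by rewrite VE mem_map //; apply: ivec_eval_inj. Qed.

(** A rotation is injective, so mapping the finite vertex set into itself already permutes it. *)
Lemma mem_binary_group (q : uquat R) :
  {in V, forall v, rot q *m ivec_eval v \in vertices P} -> q \in binary_group P.
Proof.
move=> qV; have /andP[uniqV _] := Lpres.
have rot_inj : injective (mulmx (rot q) : 'cV_3 -> 'cV_3).
  move=> u v /(congr1 (mulmx (rot q^-1%g))).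
  by rewrite !mulmxA -!rotM mulVg rot1 !mul1mx.
have uniqP : uniq (vertices P) by rewrite VE map_inj_uniq //; apply: ivec_eval_inj.
have uniqqP : uniq [seq rot q *m v | v <- vertices P] by rewrite map_inj_uniq.
apply/andP; split; first exact: rot_SO3.
apply: uniq_perm => //; apply: (uniq_min_size uniqqP _ _).2; last by rewrite size_map.
by move=> _ /mapP[v + ->]; rewrite VE => /mapP[u uV ->]; rewrite -VE; apply: qV.
Qed.

(** Neither default of [binary_eval] occurs on the list: the norm is 1 by [Lclosed], and vertices go
    to vertices by [Lpres]. *)
Lemma binary_evalE h : h \in L -> uquat_val (binary_eval h) = half_eval h.
Proof.
move=> hL; have /and5P[_ _ _ _ /allP/(_ h hL)/eqP norm] := Lclosed.
have n1 : quat_norm2 (half_eval h) == 1.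
  move/(congr1 iquat_eval): norm; rewrite !iquat_evalM iquat_eval_conj.
  case: h {hL} => [[[a b] c] d] /= [+ _ _ _]; rewrite /ev /= => e; apply/eqP; lra.
have uE : uquat_val (insubd (1%g : uquat R) (half_eval h)) = half_eval h by rewrite insubdK.
rewrite /binary_eval insubdK ?uE //; apply: mem_binary_group => v vV.
have /andP[_ /allP/(_ h hL)/allP/(_ v vV)/mapP[w wV rw]] := Lpres.
have /eqP-> : rot (insubd (1%g : uquat R) (half_eval h)) *m ivec_eval v == ivec_eval w.
  by rewrite (rot_half_eval _ _ uE) rw.
by rewrite mem_vertices.
Qed.

(** Some h of the list moves [v0] and [w0] as q does, by [rot_dot] and [Ltrans]. Then h^-1 q fixes
    both, so q is h or -h, and both are listed. *)
Lemma binary_eval_surj (q : binary P) : exists2 h, h \in L & q = binary_eval h.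
Proof.
have /and4P[v0V w0V minor /allP /= trans] := Ltrans.
have qV v : v \in V -> exists2 v', v' \in V & rot q *m ivec_eval v = ivec_eval v'.
  move=> vV; have : rot q *m ivec_eval v \in vertices P.
    by apply: binary_group_mem; [exact: (valP q) | rewrite mem_vertices].
  by rewrite VE => /mapP.
have [v1 v1V ev1] := qV _ v0V; have [w1 w1V ew1] := qV _ w0V.
have vw1 : (v1, w1) \in [seq p <- [seq (v', w') | v' <- V, w' <- V]
                        | ivec_dot t n p.1 p.2 == ivec_dot t n v0 w0].
  by rewrite mem_filter /= (rot_dot ev1 ew1) eqxx; apply/allpairsP; exists (v1, w1).
have /mapP[h hL []] := trans _ (map_f _ vw1).
move=> /esym/eqP; rewrite -(rot_half_eval _ _ (binary_evalE hL)) => /eqP hv.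
move=> /esym/eqP; rewrite -(rot_half_eval _ _ (binary_evalE hL)) => /eqP hw.
have fix_ v v' : rot q *m ivec_eval v = ivec_eval v' ->
    rot (binary_eval h) *m ivec_eval v = ivec_eval v' ->
    rot (val (binary_eval h)^-1 * val q)%g *m ivec_eval v = ivec_eval v.
  by move=> eq eh; rewrite rotM -mulmxA eq -eh mulmxA -rotM mulVg rot1 mul1mx.
have [p1|pN1] := rot_fix2 minor (fix_ _ _ ev1 hv) (fix_ _ _ ew1 hw).
  have {}p1 : (val (binary_eval h)^-1 * val q)%g = 1%g by apply: val_inj.
  exists h => //; apply: val_inj.
  by rewrite -[LHS](mulKVg (val (binary_eval h))) p1 mulg1.
have hNL : iquat_opp h \in L by have /and5P[_ _ _ /allP/(_ h hL)] := Lclosed.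
exists (iquat_opp h) => //; do 2!apply: val_inj.
rewrite [RHS]binary_evalE //.
have -> : val (val q) = quat_mul (half_eval h) (Quat (-1) 0 0 0).
  by rewrite -[val q](mulKVg (val (binary_eval h))) -pN1 -(binary_evalE hL).
case: h {hv hw hL pN1 hNL fix_} => [[[a b] c] d] /=.
by rewrite !qint_evalN; congr Quat; ring.
Qed.

Lemma binary_computes :
  computes hone (hmul t n) iquat_conj L (binary_eval : iquat -> binary P).
Proof.
have /and5P[uniqL oneL /allP conjL _ _] := Lclosed.
have mulE x y : x \in L -> y \in L -> hmul t n x y \in L /\
    binary_eval (hmul t n x y) = (binary_eval x * binary_eval y)%g.
  (* The product in the group is encoded by some listed z, which [half_evalM] identifies with
     [hmul t n x y]. *)
  move=> xL yL; have [z zL xyz] := binary_eval_surj (binary_eval x * binary_eval y)%g.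
  rewrite (_ : hmul t n x y = z) // ; apply: half_evalM.
  by rewrite -!binary_evalE // -xyz.
split=> //.
- by move=> x y xL yL; have [] := mulE _ _ xL yL.
- move=> x y xL yL /(congr1 (fun q => uquat_val (binary_val q))).
  by rewrite [LHS]binary_evalE // [RHS]binary_evalE //; apply: half_eval_inj.
- exact: binary_eval_surj.
- do 2!apply: val_inj; rewrite [LHS]binary_evalE //= /ev /=.
  by congr Quat; field.
- by move=> x y xL yL; have [] := mulE _ _ xL yL.
move=> x xL; do 2!apply: val_inj; rewrite [LHS]binary_evalE ?conjL //.
by rewrite half_eval_conj -binary_evalE.
Qed.

End Group.
End Evaluation.

(** * The three groups as explicit lists *)

Section Groups.
Local Notation "0q" := ((0, 0) : qint).
Local Notation "1q" := ((1, 0) : qint).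
Local Notation "2q" := ((2, 0) : qint).
Local Notation sq := ((0, 1) : qint).

Definition sign_changes (p : iquat) : seq iquat :=
  let: (a, b, c, d) := p in
  let pm x := undup [:: x; qint_opp x] in
  [seq (u, w) | u <- [seq (u, z) | u <- [seq (x, y) | x <- pm a, y <- pm b], z <- pm c],
                w <- pm d].

Definition hurwitz_units : seq iquat := flatten [seq sign_changes p | p <-
  [:: (2q, 0q, 0q, 0q); (0q, 2q, 0q, 0q); (0q, 0q, 2q, 0q); (0q, 0q, 0q, 2q);
      (1q, 1q, 1q, 1q)]].

(* i, (i + j) / sqrt 2, (1 + i + j + k) / 2 and (1 + i) / sqrt 2, with s = sqrt 2 *)
(* where needed, and (s + j / s + k) / 2 for the golden ratio s; the index is the *)
(* order.                                                                         *)
Definition i4 : iquat := (0q, 2q, 0q, 0q).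
Definition ij4 : iquat := (0q, sq, sq, 0q).
Definition omega6 : iquat := (1q, 1q, 1q, 1q).
Definition zeta8 : iquat := (sq, sq, 0q, 0q).
Definition zeta10 : iquat := (sq, 0q, (-1, 1), 1q).

(* Cosets of T^*, whose elements are the Hurwitz units. *)
Definition octahedral_units : seq iquat :=
  hurwitz_units ++ [seq hmul 0 2 ij4 h | h <- hurwitz_units].

(** The fifth power of [zeta10] is -1, in T^*, and no smaller positive power lies there; so the
    first five powers represent the five cosets. *)
Definition icosian_units : seq iquat :=
  [seq hmul 1 1 g h | g <- traject (hmul 1 1 zeta10) hone 5,
                 h <- hurwitz_units].

Definition tetrahedron_ivecs : seq ivec :=
  let m := qint_opp 1q in [:: (1q, 1q, 1q); (1q, m, m); (m, 1q, m); (m, m, 1q)].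

Definition octahedron_ivecs : seq ivec :=
  let m := qint_opp 1q in
  [:: (1q, 0q, 0q); (m, 0q, 0q); (0q, 1q, 0q); (0q, m, 0q); (0q, 0q, 1q); (0q, 0q, m)].

Definition icosahedron_ivecs : seq ivec :=
  let m := qint_opp 1q in let u := sq in let v := qint_opp u in
  [:: (0q, 1q, u); (0q, 1q, v); (0q, m, u); (0q, m, v);
      (1q, u, 0q); (1q, v, 0q); (m, u, 0q); (m, v, 0q);
      (u, 0q, 1q); (v, 0q, 1q); (u, 0q, m); (v, 0q, m)].

(** If b were nonzero, the exponent of p would be even in a^2 and odd in p b^2. *)
Lemma sqrt_prime_free (R : realType) p : prime p -> forall a b : int,
  a%:~R + b%:~R * Num.sqrt p%:R = 0 :> R -> a = 0 /\ b = 0.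
Proof.
move=> p_pr a b /eqP; rewrite addr_eq0 => /eqP e.
have {}e : (`|a| ^ 2 = p * `|b| ^ 2)%N.
  apply/eqP; rewrite -(eqr_nat R) natrM !natrX !natr_absz !intr_norm !real_normK ?num_real //.
  by rewrite e sqrrN exprMn sqr_sqrtr ?ler0n // mulrC.
have [b0|b_n0] := eqVneq b 0.
  by split=> //; move: e; rewrite b0 muln0 => /eqP; rewrite expn_eq0 andbT absz_eq0 => /eqP.
have := congr1 (odd \o logn p) e.
by rewrite /= lognX lognM ?expn_gt0 ?absz_gt0 ?b_n0 ?prime_gt0 // lognX
  (logn_prime p p_pr) eqxx oddD !oddM.
Qed.

Section Evaluations.
Variable R : realType.

Lemma sqrt2_sqr : Num.sqrt 2 ^+ 2 = 2%:~R + 0%:~R * Num.sqrt 2 :> R.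
Proof. by rewrite sqr_sqrtr // mul0r addr0. Qed.

Lemma sqrt2_free (a b : int) : a%:~R + b%:~R * Num.sqrt 2 = 0 :> R -> a = 0 /\ b = 0.
Proof. exact: (@sqrt_prime_free R 2). Qed.

Lemma golden_sqr : golden R ^+ 2 = 1%:~R + 1%:~R * golden R.
Proof.
rewrite /golden; have : Num.sqrt 5 ^+ 2 = 5 :> R by rewrite sqr_sqrtr.
by move: (Num.sqrt 5) => r r2; lra.
Qed.

Lemma golden_free (a b : int) : a%:~R + b%:~R * golden R = 0 -> a = 0 /\ b = 0.
Proof.
move=> e; have [] // := @sqrt_prime_free R 5 _ (a + a + b) b.
  by rewrite !rmorphD /=; move: e; rewrite /golden => e; lra.
by move=> + b0; rewrite b0 => ?; split=> //; lra.
Qed.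

(** The coordinates are integers; taking s = sqrt 2 gives T^* the same encoding as O^*, as
    [Tstar_in_OstarE] requires. *)
Lemma tetrahedron_verticesE : vertices (tetrahedron R) =
  map (ivec_eval (Num.sqrt 2)) tetrahedron_ivecs.
Proof.
by rewrite /= /qint_eval /=; do !congr cons; apply: mkv3_eq; rewrite ?rmorphN /=; ring.
Qed.

Lemma octahedron_verticesE : vertices (octahedron R) =
  map (ivec_eval (Num.sqrt 2)) octahedron_ivecs.
Proof.
by rewrite /= /qint_eval /=; do !congr cons; apply: mkv3_eq; rewrite ?rmorphN /=; ring.
Qed.

Lemma icosahedron_verticesE : vertices (icosahedron R) =
  map (ivec_eval (golden R)) icosahedron_ivecs.
Proof.
by rewrite /= /qint_eval /=; do !congr cons; apply: mkv3_eq; rewrite ?rmorphN /=; ring.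
Qed.

Definition Tstar_el : iquat -> Tstar R := @binary_eval R (Num.sqrt 2) (tetrahedron R).
Definition Ostar_el : iquat -> Ostar R := @binary_eval R (Num.sqrt 2) (octahedron R).
Definition Istar_el : iquat -> Istar R := @binary_eval R (golden R) (icosahedron R).

Lemma Tstar_computes : computes hone (hmul 0 2) iquat_conj hurwitz_units Tstar_el.
Proof.
apply: (binary_computes sqrt2_sqr sqrt2_free tetrahedron_verticesE
  (v0 := (1q, 1q, 1q)) (w0 := (1q, qint_opp 1q, qint_opp 1q))); by vm_compute.
Qed.

Lemma Ostar_computes : computes hone (hmul 0 2) iquat_conj octahedral_units Ostar_el.
Proof.
apply: (binary_computes sqrt2_sqr sqrt2_free octahedron_verticesE
  (v0 := (1q, 0q, 0q)) (w0 := (0q, 1q, 0q))); by vm_compute.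
Qed.

Lemma Istar_computes : computes hone (hmul 1 1) iquat_conj icosian_units Istar_el.
Proof.
apply: (binary_computes golden_sqr golden_free icosahedron_verticesE
  (v0 := (0q, 1q, sq)) (w0 := (1q, sq, 0q))); by vm_compute.
Qed.

Lemma Tstar_in_OstarE h : h \in octahedral_units ->
  (Ostar_el h \in Tstar_in_Ostar R) = (h \in hurwitz_units).
Proof.
move=> hO; rewrite inE.
have elO : uquat_val (Ostar_el h) = half_eval (Num.sqrt 2) h.
  apply: (binary_evalE sqrt2_sqr sqrt2_free octahedron_verticesE _ _ hO); by vm_compute.
have elT m : m \in hurwitz_units -> uquat_val (Tstar_el m) = half_eval (Num.sqrt 2) m.
  move=> mT.
  apply: (binary_evalE sqrt2_sqr sqrt2_free tetrahedron_verticesE _ _ mT); by vm_compute.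
apply/idP/idP => [hT|hT].
  have [m mT] := el_surj Tstar_computes (Binary hT).
  move/(congr1 (fun q : Tstar R => uquat_val q)).
  by rewrite elT //= elO => /(half_eval_inj sqrt2_free) ->.
rewrite (_ : binary_val (Ostar_el h) = binary_val (Tstar_el h)).
  exact: (valP (Tstar_el h)).
by apply: val_inj; rewrite /= elO elT.
Qed.

(** * Tables of counts and representatives *)

Lemma Tstar_orders : all (fun x => seq_order hone (hmul 0 2) x \in [:: 1; 2; 3; 4; 6]%N)
  hurwitz_units.
Proof. by vm_compute. Qed.

Lemma Ostar_orders : all (fun x => seq_order hone (hmul 0 2) x \in [:: 1; 2; 3; 4; 6; 8]%N)
  octahedral_units.
Proof. by vm_compute. Qed.

Lemma Istar_orders :
  all (fun x => seq_order hone (hmul 1 1) x \in [:: 1; 2; 3; 4; 5; 6; 10]%N) icosian_units.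
Proof. by vm_compute. Qed.

Lemma seq_order_le e mul (L : seq iquat) (ds : seq nat) :
  all (fun x => seq_order e mul x \in ds) L -> all (leq^~ order_bound) ds ->
  all (fun x => (seq_order e mul x <= order_bound)%N) L.
Proof. by move=> + /allP ds_le; apply: sub_all => x /ds_le. Qed.

Definition Tstar_order_le := seq_order_le Tstar_orders isT.
Definition Ostar_order_le := seq_order_le Ostar_orders isT.
Definition Istar_order_le := seq_order_le Istar_orders isT.

Lemma Tstar_counts d : class_counts [set: Tstar R] d =
  match d with
  | 1 => (1, 1, 1, 1)
  | 2 => (1, 1, 1, 1)
  | 3 => (8, 2, 1, 1)
  | 4 => (6, 1, 1, 1)
  | 6 => (8, 2, 1, 1)
  | _ => (0, 0, 0, 0)
  end%N.
Proof.
have one := one_class_counts_el Tstar_computes Tstar_order_le.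
have two := power_reps_el Tstar_computes Tstar_order_le.
have [|nd] := boolP (d \in [:: 1; 2; 3; 4; 6]%N).
  rewrite !inE => /or4P[| | |/orP[]] /eqP ->.
  - by rewrite (one _ hone); vm_compute.
  - by rewrite (one _ (iquat_opp hone)); vm_compute.
  (* The cube of [omega6] is -1, so its opposite has order 3. *)
  - by have [|| -> _] := two 3%N 2%N (iquat_opp omega6); vm_compute.
  - by rewrite (one _ i4); vm_compute.
  - by have [|| -> _] := two 6%N 5%N omega6; vm_compute.
rewrite (no_class_counts_el Tstar_computes Tstar_order_le (order_seq_nil Tstar_orders nd)).
(* Splitting past the largest order exposes the default branch of the table. *)
by do 7?[case: d nd => [|d] nd //].
Qed.

Lemma Ostar_counts d : class_counts [set: Ostar R] d =
  match d with
  | 1 => (1, 1, 1, 1)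
  | 2 => (1, 1, 1, 1)
  | 3 => (8, 1, 1, 1)
  | 4 => (18, 2, 2, 2)
  | 6 => (8, 1, 1, 1)
  | 8 => (12, 2, 2, 1)
  | _ => (0, 0, 0, 0)
  end%N.
Proof.
have one := one_class_counts_el Ostar_computes Ostar_order_le.
have two := power_reps_el Ostar_computes Ostar_order_le.
have real := real_reps_el Ostar_computes Ostar_order_le.
have [|nd] := boolP (d \in [:: 1; 2; 3; 4; 6; 8]%N).
  rewrite !inE => /or4P[| | |/or3P[| |]] /eqP ->.
  - by rewrite (one _ hone); vm_compute.
  - by rewrite (one _ (iquat_opp hone)); vm_compute.
  - by rewrite (one _ (iquat_opp omega6)); vm_compute.
  - by rewrite (real _ i4 ij4); vm_compute.
  - by rewrite (one _ omega6); vm_compute.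
  - by have [|| -> _] := two 8%N 3%N zeta8; vm_compute.
rewrite (no_class_counts_el Ostar_computes Ostar_order_le (order_seq_nil Ostar_orders nd)).
by do 9?[case: d nd => [|d] nd //].
Qed.

Lemma Istar_counts d : class_counts [set: Istar R] d =
  match d with
  | 1 => (1, 1, 1, 1)
  | 2 => (1, 1, 1, 1)
  | 3 => (20, 1, 1, 1)
  | 4 => (30, 1, 1, 1)
  | 5 => (24, 2, 2, 1)
  | 6 => (20, 1, 1, 1)
  | 10 => (24, 2, 2, 1)
  | _ => (0, 0, 0, 0)
  end%N.
Proof.
have one := one_class_counts_el Istar_computes Istar_order_le.
have two := power_reps_el Istar_computes Istar_order_le.
have [|nd] := boolP (d \in [:: 1; 2; 3; 4; 5; 6; 10]%N).
  rewrite !inE => /or4P[| | |/or4P[| | |]] /eqP ->.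
  - by rewrite (one _ hone); vm_compute.
  - by rewrite (one _ (iquat_opp hone)); vm_compute.
  - by rewrite (one _ (iquat_opp omega6)); vm_compute.
  - by rewrite (one _ i4); vm_compute.
  - by have [|| -> _] := two 5%N 2%N (iquat_opp zeta10); vm_compute.
  - by rewrite (one _ omega6); vm_compute.
  - by have [|| -> _] := two 10%N 3%N zeta10; vm_compute.
rewrite (no_class_counts_el Istar_computes Istar_order_le (order_seq_nil Istar_orders nd)).
by do 11?[case: d nd => [|d] nd //].
Qed.

Lemma Tstar_reps d (g : Tstar R) : d = 3%N \/ d = 6%N -> #[g]%g = d ->
  two_class_reps [set: Tstar R] d g g^-1%g.
Proof.
have two := power_reps_el Tstar_computes Tstar_order_le.
(* The inverse is the power d - 1, hence the exponents 2 and 5. *)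
move=> d36 gd; rewrite invg_expg gd; case: d36 gd => ->.
  have [|| _ reps] := two 3%N 2%N (iquat_opp omega6);
  [by vm_compute | by vm_compute | exact: reps].
have [|| _ reps] := two 6%N 5%N omega6; [by vm_compute | by vm_compute | exact: reps].
Qed.

(** Evaluation shows that the elements of order 4 inside T^* are all conjugate to [i4], and those
    outside to [ij4]. *)
Lemma Ostar_reps4 (g1 g2 : Ostar R) : #[g1]%g = 4%N -> #[g2]%g = 4%N ->
  g1 \in Tstar_in_Ostar R -> g2 \notin Tstar_in_Ostar R ->
  two_class_reps [set: Ostar R] 4%N g1 g2.
Proof.
have [h1 h1O ->] := el_surj Ostar_computes g1; have [h2 h2O ->] := el_surj Ostar_computes g2.
rewrite (Tstar_in_OstarE h1O) (Tstar_in_OstarE h2O).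
have oE h (hO : h \in octahedral_units) :=
  order_el Ostar_computes hO (allP Ostar_order_le _ hO).
rewrite (oE _ h1O) (oE _ h2O).
move=> h1_4 h2_4 h1T h2T.
have h4 h : h \in octahedral_units -> seq_order hone (hmul 0 2) h = 4%N ->
    h \in order_seq hone (hmul 0 2) octahedral_units 4%N.
  by move=> hO h_4; rewrite mem_filter h_4 eqxx hO.
have conjT : all [in conjugate_seq (hmul 0 2) iquat_conj octahedral_units i4]
    [seq x <- order_seq hone (hmul 0 2) octahedral_units 4%N | x \in hurwitz_units].
  by vm_compute.
have conjNT : all [in conjugate_seq (hmul 0 2) iquat_conj octahedral_units ij4]
    [seq x <- order_seq hone (hmul 0 2) octahedral_units 4%N | x \notin hurwitz_units].
  by vm_compute.
apply: (@two_class_repsJ _ _ _ (Ostar_el i4) (Ostar_el ij4)).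
- rewrite (mem_conjugate_seq Ostar_computes _ h1O); last by vm_compute.
  by apply: (allP conjT); rewrite mem_filter h1T h4.
- rewrite (mem_conjugate_seq Ostar_computes _ h2O); last by vm_compute.
  by apply: (allP conjNT); rewrite mem_filter h2T h4.
by apply: (two_class_reps_el Ostar_computes Ostar_order_le); vm_compute.
Qed.

Lemma Ostar_reps8 (g : Ostar R) : #[g]%g = 8%N ->
  two_class_reps [set: Ostar R] 8%N g (g ^+ 3)%g.
Proof.
have [|| _ reps] := power_reps_el Ostar_computes Ostar_order_le
  (d := 8%N) (k := 3%N) (x := zeta8); [by vm_compute | by vm_compute | exact: reps].
Qed.

Lemma Istar_reps5 (g : Istar R) : #[g]%g = 5%N ->
  two_class_reps [set: Istar R] 5%N g (g ^+ 2)%g.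
Proof.
have [|| _ reps] := power_reps_el Istar_computes Istar_order_le
  (d := 5%N) (k := 2%N) (x := iquat_opp zeta10); [by vm_compute | by vm_compute | exact: reps].
Qed.

Lemma Istar_reps10 (g : Istar R) : #[g]%g = 10%N ->
  two_class_reps [set: Istar R] 10%N g (g ^+ 3)%g.
Proof.
have [|| _ reps] := power_reps_el Istar_computes Istar_order_le
  (d := 10%N) (k := 3%N) (x := zeta10); [by vm_compute | by vm_compute | exact: reps].
Qed.

End Evaluations.
End Groups.
End Quaternions.

Theorem proposition7 (R : realType) :
  (let G := [set: Tstar R]%G in
   (forall d : nat, d %| #|G| ->
      (num_elements G d, num_classes G d, num_inv_pair_classes G d,
       num_cyclic_classes G d) =
      match d with
      | 1 => (1, 1, 1, 1)
      | 2 => (1, 1, 1, 1)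
      | 3 => (8, 2, 1, 1)
      | 4 => (6, 1, 1, 1)
      | 6 => (8, 2, 1, 1)
      | _ => (0, 0, 0, 0)
      end) /\
   (forall (d : nat) (g : Tstar R), d = 3 \/ d = 6 -> #[g]%g = d ->
      two_class_reps G d g g^-1%g))
  /\
  (let G := [set: Ostar R]%G in
   (forall d : nat, d %| #|G| ->
      (num_elements G d, num_classes G d, num_inv_pair_classes G d,
       num_cyclic_classes G d) =
      match d with
      | 1 => (1, 1, 1, 1)
      | 2 => (1, 1, 1, 1)
      | 3 => (8, 1, 1, 1)
      | 4 => (18, 2, 2, 2)
      | 6 => (8, 1, 1, 1)
      | 8 => (12, 2, 2, 1)
      | _ => (0, 0, 0, 0)
      end) /\
   (forall g1 g2 : Ostar R, #[g1]%g = 4 -> #[g2]%g = 4 ->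
      g1 \in Tstar_in_Ostar R -> g2 \notin Tstar_in_Ostar R ->
      two_class_reps G 4 g1 g2) /\
   (forall g : Ostar R, #[g]%g = 8 -> two_class_reps G 8 g (g ^+ 3)%g))
  /\
  (let G := [set: Istar R]%G in
   (forall d : nat, d %| #|G| ->
      (num_elements G d, num_classes G d, num_inv_pair_classes G d,
       num_cyclic_classes G d) =
      match d with
      | 1 => (1, 1, 1, 1)
      | 2 => (1, 1, 1, 1)
      | 3 => (20, 1, 1, 1)
      | 4 => (30, 1, 1, 1)
      | 5 => (24, 2, 2, 1)
      | 6 => (20, 1, 1, 1)
      | 10 => (24, 2, 2, 1)
      | _ => (0, 0, 0, 0)
      end) /\
   (forall g : Istar R, #[g]%g = 5 -> two_class_reps G 5 g (g ^+ 2)%g) /\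
   (forall g : Istar R, #[g]%g = 10 -> two_class_reps G 10 g (g ^+ 3)%g)).
Proof.
split; [split | split; [split; [| split] | split; [| split]]].
- by move=> d _; apply: Tstar_counts.
- exact: Tstar_reps.
- by move=> d _; apply: Ostar_counts.
- exact: Ostar_reps4.
- exact: Ostar_reps8.
- by move=> d _; apply: Istar_counts.
- exact: Istar_reps5.
- exact: Istar_reps10.
Qed.
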